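(* Let $a\in\mathbb{N}$, $b\in\mathbb{Z}$, $c\in\mathbb{R}_{>0}$, $d\in\mathbb{R}$ be constants. Put \[D:=\frac{a\,\varphi((a,b))}{c\,(a,b)}\] and \[M:=\left\{ n\in\mathbb{N}:\ n>\max\Big\{-\frac{b}{a},-\frac{d}{c}\Big\}\ \text{ and }\ \frac{\varphi(an+b)}{cn+d}\leq D\right\}.\] Then the set \[L:=\left\{\frac{\varphi(an+b)}{cn+d}:\ n\in M\right\}\] is dense in the real interval $]0,D]$. Furthermore, for arbitrary $t\in\mathbb{N}$, we can restrict $L$ (i.e. restrict the $n\in M$ allowed in the definition of $L$) by any of the following conditions on $n$ such that $L$ remains dense in $]0,D]$: \begin{enumerate} \item[(1)] $\frac{an+b}{(a,b)}$ is squarefree; \item[(2)] $\frac{an+b}{(a,b)}$ and $t$ are coprime; \item[(3)] there is at most one prime factor $p$ of $\frac{an+b}{(a,b)}$ such that $p\not\equiv 1 \bmod a$, and if it exists, it has multiplicity $1$ and $a>1$. \end{enumerate}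
   Context: $\mathbb{N}$ is the set of positive integers, $\varphi$ is Euler's totient function, and $(a,b)=\gcd(a,b)$. The half-open interval is $]0,D]=\{x\in\mathbb{R}: 0<x\le D\}$. *)

(* Defs.v *)
From mathcomp Require Import all_boot all_order all_algebra.
From mathcomp Require Import boolp classical_sets reals topology normedtype.
Import Order.TTheory GRing.Theory Num.Theory.
Import numFieldNormedType.Exports.

Set Implicit Arguments.
Unset Strict Implicit.
Unset Printing Implicit Defensive.

Local Open Scope classical_set_scope.
Local Open Scope ring_scope.

(* [L] is a subset of [A] whose closure relative to [A] is all of [A]; the
   library's [dense] only covers density in the whole space. *)
Definition dense_in (T : topologicalType) (A L : set T) : Prop :=
  L `<=` A /\ A `<=` closure L.

Definition squarefree (m : nat) : Prop :=
  forall k : nat, (k ^ 2 %| m)%N -> k = 1%N.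

Definition gcd_ab (a : nat) (b : int) : nat := gcdn a `|b|%N.

(* The absolute value only transports the integer a n + b to [nat], the domain
   of [totient]: a n + b > 0 whenever n > - b / a, as for all n in [M_set]. *)
Definition lin (a : nat) (b : int) (n : nat) : nat :=
  absz (a%:Z * n%:Z + b).

Definition lin_red (a : nat) (b : int) (n : nat) : nat :=
  (lin a b n %/ gcd_ab a b)%N.

Section Ratio.
Variables (R : realType) (a : nat) (b : int) (c d : R).

Definition ratio (n : nat) : R :=
  (totient (lin a b n))%:R / (c * n%:R + d).

Definition D_bound : R :=
  (a * totient (gcd_ab a b))%:R / (c * (gcd_ab a b)%:R).

Definition M_set : set nat :=
  [set n | [/\ (0 < n)%N,
               Num.max (- (b%:~R / a%:R)) (- (d / c)) < n%:R
             & ratio n <= D_bound]].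

Definition L_set : set R := ratio @` M_set.

Definition L_restr (P : nat -> Prop) : set R :=
  ratio @` [set n | M_set n /\ P n].

End Ratio.

Definition exceptional_prime (a m p : nat) : Prop :=
  [/\ prime p, (p %| m)%N & p <> 1 %[mod a]].

Definition almost_all_primes_1mod (a m : nat) : Prop :=
  (forall p q : nat,
     exceptional_prime a m p -> exceptional_prime a m q -> p = q) /\
  (forall p : nat,
     exceptional_prime a m p -> logn p m = 1%N /\ (1 < a)%N).

(* Main.v *)
From HB Require Import structures.
Require Import Defs.
From mathcomp Require Import all_boot all_order all_algebra.
From mathcomp Require Import boolp classical_sets reals topology normedtype sequences exp.
From mathcomp Require Import ring lra zify.
Import Order.TTheory GRing.Theory Num.Theory.
Import numFieldNormedType.Exports.
Local Open Scope classical_set_scope.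
Local Open Scope ring_scope.

(** Why the theorem is true.

    Write g = (a, b) and a' = a / g. A large m congruent to b / g modulo a'
    satisfies g m = a n + b for some positive n, and if m is prime to g then
    phi (a n + b) / (c n + d) = D (phi m / m) (1 + o(1)) ([ratio_factor]). So
    it suffices to approach every y in ]0, 1[ from below by values phi m / m
    with m in that class. Take m = q p_1 ... p_r, where q is a large prime
    congruent to b / g modulo a' and the p_i are the successive primes beyond
    q congruent to 1 modulo a. Each p_i multiplies phi m / m by 1 - 1 / p_i,
    which is close to 1, while the product over all these primes is 0: the
    values decrease to 0 by small steps, and one of them lies just below y
    ([totient_ratio_approx]). Such an m is squarefree, prime to t when q > t,
    and q is its only prime factor that may fail to be 1 modulo a; so one m
    serves all three conditions.

    What remains is Dirichlet's theorem: there are infinitely many primes in an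
    invertible class modulo k, and the sum of their inverses diverges. It is
    proved in the form of Mertens, with real functions on the unit group of
    Z/k in place of complex characters. For f on the unit group let

      T_N f (x) = sum over n <= N of Lambda(n) / n * f (x n),
      L f (x)   = sum over all n of f (x n) / n     (f of mean zero),

    with Lambda the von Mangoldt function. The convolution identity for ln gives
    T_N (L f) = O(1) ([prime_sum_image]); its Moebius inverse gives
    T_N f = - f ln N + O(1) when L f = 0 ([prime_sum_kernel]); and Mertens'
    theorem gives T_N 1 = ln N + O(1) ([prime_sum_units]). The first two show that
    the image and the kernel of L meet in 0, hence span the mean-zero
    functions ([mean_zero_decomp]). Therefore T_N / ln N converges to an operator
    E, which is 1 on constants, 0 on the image of L and - 1 on its kernel, and
    which is a convolution by nonnegative weights of sum 1.

    The kernel of L is 0. For v in the kernel, |v| = |E v| <= E |v| and both ends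
    have the same sum, so |v| is fixed by E, that is, constant
    ([kernel_abs_const]). Applied to v and to the sum of v and a translate, this
    forces v, once normalized, to be a real character
    ([kernel_real_character]). But the series chi n / n of a real character
    does not have sum 0, by the hyperbola method
    ([real_character_nonvanishing]). So E is the mean value, and every
    invertible class has the same positive logarithmic density of primes
    ([limit_uniform], [sum_ln_prime_ge]). *)

(** * Real sequences, Abel summation and logarithms *)

Section RealSequences.
Variable R : realType.
Implicit Types (f g u e : nat -> R) (n N : nat).

(** The supremum of the lower bounds [u N - e N] satisfies the estimate, so that the
    limit comes with its rate. *)
Lemma limit_with_rate u e :
  (forall N M, (N <= M)%N -> `|u M - u N| <= e N) ->
  exists C, forall N, `|u N - C| <= e N.
Proof.
move=> ue.
have e0 N : 0 <= e N by apply: le_trans (ue N N (leqnn N)); rewrite normr_ge0.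
(* Every lower bound is below every upper bound. *)
have sep N M : u N - e N <= u M + e M.
  have [NM|/ltnW MN] := leqP N M.
    have := ue _ _ NM; have := e0 M; rewrite ler_norml => ? /andP[]; lra.
  have := ue _ _ MN; have := e0 N; rewrite ler_norml => ? /andP[]; lra.
pose S := [set u N - e N | N in [set: nat]].
have S0 : S !=set0 by exists (u 0%N - e 0%N), 0%N.
have ubS M : ubound S (u M + e M) by move=> _ [N _ <-].
exists (sup S) => N.
have lo : u N - e N <= sup S.
  by apply: ub_le_sup; [exists (u 0%N + e 0%N) | exists N].
have hi : sup S <= u N + e N by apply: ge_sup.
by rewrite ler_distlC; apply/andP; split; lra.
Qed.

(** Summation by parts: the partial sums of [f] are bounded and the total
    variation of the weight [g] on [a, b[ is at most [g a]. *)
Lemma abel_bound f g a b B :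
  (forall n, `|\sum_(0 <= i < n) f i| <= B) ->
  (forall n, (a <= n)%N -> 0 <= g n) ->
  (forall n, (a <= n)%N -> g n.+1 <= g n) ->
  `|\sum_(a <= n < b) f n * g n| <= B * g a *+ 2.
Proof.
move=> fB g0 gdec.
have B0 : 0 <= B by apply: le_trans (fB 0%N); rewrite normr_ge0.
have [ba|/ltnW ab] := leqP b a.
  by rewrite big_geq // normr0 mulrn_wge0 // mulr_ge0 // g0.
pose F n := \sum_(0 <= i < n) f i.
suff E : `|\sum_(a <= n < b) f n * g n - F b * g b| <= B * g a + B * (g a - g b).
  have H1 : `|F b * g b| <= B * g b.
    by rewrite normrM (ger0_norm (g0 _ ab)); apply: ler_wpM2r; [exact: g0 | exact: fB].
  move: E H1; set x := \sum_(_ <= _ < _) _; set y := F b * g b; clearbody x y.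
  by rewrite !ler_norml => /andP[? ?] /andP[? ?]; apply/andP; split; lra.
elim: b ab => [|b IH]; rewrite ?leqn0.
  move=> /eqP a0; rewrite a0 big_geq // sub0r normrN /F big_geq // mul0r normr0.
  by rewrite subrr mulr0 addr0 mulr_ge0 // g0 // a0.
rewrite leq_eqVlt => /predU1P[<-|ab].
  rewrite big_geq // sub0r normrN subrr mulr0 addr0 normrM (ger0_norm (g0 _ _)) //.
  by apply: ler_wpM2r; [exact: g0 | exact: fB].
have {}ab : (a <= b)%N by [].
rewrite big_nat_recr //=.
have -> : \sum_(a <= i < b) f i * g i + f b * g b - F b.+1 * g b.+1 =
  (\sum_(a <= i < b) f i * g i - F b * g b) + F b.+1 * (g b - g b.+1).
  by rewrite /F big_nat_recr //=; ring.
apply: le_trans (ler_normD _ _) _.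
have H : `|F b.+1 * (g b - g b.+1)| <= B * (g b - g b.+1).
  by rewrite normrM (ger0_norm (_ : 0 <= g b - g b.+1)) ?subr_ge0 ?gdec // ler_wpM2r
      ?subr_ge0 ?gdec //; apply: fB.
have := lerD (IH ab) H; lra.
Qed.

Lemma ln_natS_sub n : (0 < n)%N -> ln n.+1%:R - ln n%:R <= n%:R^-1 :> R.
Proof.
move=> n0; have n0' : 0 < n%:R :> R by rewrite ltr0n.
rewrite -ln_div ?posrE ?ltr0n //.
have -> : n.+1%:R / n%:R = 1 + n%:R^-1 :> R by rewrite -natr1; field; rewrite gt_eqF.
by apply: le_ln1Dx; apply: lt_trans (_ : 0 < _); rewrite ?oppr_lt0 ?invr_gt0.
Qed.

Lemma ln_nat_ge0 n : 0 <= ln n%:R :> R.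
Proof.
by case: n => [|n]; [rewrite ln0|apply: ln_ge0; rewrite ler1n].
Qed.

Lemma ler_ln_nat m n : (0 < m)%N -> (m <= n)%N -> ln m%:R <= ln n%:R :> R.
Proof.
by move=> m0 mn; rewrite ler_ln ?posrE ?ltr0n ?ler_nat // (leq_trans m0).
Qed.

Lemma lnM_nat m n : (0 < m)%N -> (0 < n)%N ->
  ln (m * n)%:R = ln m%:R + ln n%:R :> R.
Proof. by move=> m0 n0; rewrite natrM lnM // posrE ltr0n. Qed.

Lemma ln_fact_sum N : ln N`!%:R = \sum_(1 <= n < N.+1) ln n%:R :> R.
Proof.
elim: N => [|N IH]; first by rewrite big_geq // fact0 ln1.
by rewrite factS lnM_nat ?fact_gt0 // IH [RHS]big_nat_recr //= addrC.
Qed.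

Lemma ln_fact_ge N : N%:R * ln N%:R - N%:R <= ln N`!%:R :> R.
Proof.
case: N => [|N]; first by rewrite mul0r subr0 fact0 ln1.
elim: N => [|N IH]; first by rewrite ln1 mulr0 sub0r lerN10.
rewrite factS lnM_nat ?fact_gt0 //.
have := ln_natS_sub _ (ltn0Sn N).
have n0 : 0 < N.+1%:R :> R by rewrite ltr0n.
rewrite -(ler_pM2l n0) divff ?gt_eqF // => H.
have E : N.+2%:R = N.+1%:R + 1 :> R by rewrite natr1.
by move: H; set l := ln N.+2%:R; rewrite E; lra.
Qed.

Lemma ln_fact_le N : ln N`!%:R <= N%:R * ln N%:R :> R.
Proof.
rewrite ln_fact_sum mulr_natl.
have -> : ln N%:R *+ N = \sum_(1 <= n < N.+1) ln N%:R :> R.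
  by rewrite sumr_const_nat subn1.
apply: ler_sum_nat => i /andP[i0 iN]; exact: ler_ln_nat.
Qed.

(** The function ln x / x decreases once ln x >= 1; starting at 4 leaves room to
    verify this from ln 2 >= 1/2. *)
Lemma ln_div_antitone n : (4 <= n)%N ->
  ln n.+1%:R / n.+1%:R <= ln n%:R / n%:R :> R.
Proof.
move=> n4; have n0 : (0 < n)%N by apply: leq_trans n4.
have n0' : 0 < n%:R :> R by rewrite ltr0n.
have ln2 : 2^-1 <= ln 2 :> R.
  have := @le_ln1Dx R (- 2^-1) ltac:(lra).
  have -> : 1 + - 2^-1 = 2^-1 :> R by lra.
  rewrite lnV ?posrE //; lra.
have l1 : 1 <= ln n%:R :> R.
  apply: le_trans (_ : ln 4 <= _); last exact: (@ler_ln_nat 4).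
  by rewrite (_ : 4 = (2 * 2)%:R) // lnM_nat //; lra.
have := ln_natS_sub _ n0; rewrite ler_pdivrMr ?ltr0n // mulrAC ler_pdivlMr //.
rewrite -(ler_pM2l n0') divff ?gt_eqF // => H.
have E : n.+1%:R = n%:R + 1 :> R by rewrite natr1.
by move: H; set l := ln n.+1%:R; rewrite E; lra.
Qed.

(** This is Stirling's lower bound N ln N - N <= ln N! in the form in which it
    bounds error terms summed over d <= N. *)
Lemma sum_ln_ratio_le N : \sum_(1 <= d < N.+1) (ln N%:R - ln d%:R) <= N%:R :> R.
Proof.
rewrite sumrB -ln_fact_sum sumr_const_nat subn1 -[X in X - _ <= _]mulr_natl.
have := ln_fact_ge N; lra.
Qed.

End RealSequences.

(** * Sums over divisors, the Moebius and von Mangoldt functions *)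

Section DivisorSums.
Variable R : realType.
Implicit Types (F : nat -> R) (n m p e N : nat).

Lemma sum_divisorsE F n : (0 < n)%N ->
  \sum_(d <- divisors n) F d = \sum_(1 <= d < n.+1 | (d %| n)%N) F d.
Proof.
move=> n0; rewrite -[RHS]big_filter; apply: perm_big.
apply: uniq_perm; rewrite ?divisors_uniq ?filter_uniq ?iota_uniq // => d.
rewrite mem_filter mem_index_iota -dvdn_divisors // ltnS.
case dn: (d %| n)%N => //=.
by rewrite (dvdn_leq n0 dn) (dvdn_gt0 n0 dn).
Qed.

(** The pairs (d, m) with d m <= N, grouped by the product d m on the left and by
    d on the right. Induction on N adds the pairs of product N. *)
Lemma sum_divisors_swap (F : nat -> nat -> R) N :
  \sum_(1 <= n < N.+1) \sum_(d <- divisors n) F d (n %/ d)%N =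
  \sum_(1 <= d < N.+1) \sum_(1 <= m < (N %/ d).+1) F d m.
Proof.
elim: N => [|N IH]; first by rewrite !big_geq.
rewrite big_nat_recr //= IH (sum_divisorsE (fun d =>
    F d _)) // [in X in _ + X]big_mkcond /=.
have -> : \sum_(1 <= d < N.+1) \sum_(1 <= m < (N %/ d).+1) F d m =
          \sum_(1 <= d < N.+2) \sum_(1 <= m < (N %/ d).+1) F d m.
  by rewrite [RHS]big_nat_recr //= divn_small // [X in _ + X]big_geq // addr0.
rewrite -big_split /=; apply: eq_big_nat => d /andP[d0 _].
rewrite divnS //; case: ifP => dN; last by rewrite addr0 ?dN.
by rewrite dN !add1n [RHS]big_nat_recr.
Qed.

(** A divisor of p^e m, for p prime to m, is uniquely p^i d with i <= e and d | m.
    Iterated over the primes, this replaces the theory of multiplicative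
    functions in the two evaluations of divisor sums below. *)
Lemma sum_divisors_pfactor F p e m : prime p -> coprime p m -> (0 < m)%N ->
  \sum_(d <- divisors (p ^ e * m)) F d =
  \sum_(i < e.+1) \sum_(d <- divisors m) F (p ^ i * d)%N.
Proof.
move=> pp pm m0; have p0 := prime_gt0 pp.
have pcop d : (d %| m)%N -> coprime p d by move=> dm; apply: coprime_dvdr dm pm.
rewrite -(big_mkord xpredT (fun i => \sum_(d <- divisors m) F (p ^ i * d)%N)).
rewrite -(big_allpairs_dep (h := fun i d => (p ^ i * d)%N) (F := F)).
apply: perm_big; apply: uniq_perm; rewrite ?divisors_uniq //.
  apply: allpairs_uniq; rewrite ?divisors_uniq ?iota_uniq //.
  move=> u v /allpairsP[[x y] [_ yd ->]] /allpairsP[[x' y'] [_ yd' ->]] E.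
  rewrite /= in yd yd' E *.
  have lg t z : z \in divisors m -> logn p (p ^ t * z) = t.
    rewrite -dvdn_divisors // => zm.
    by rewrite lognM ?expn_gt0 ?p0 ?(dvdn_gt0 m0) // pfactorK // logn_coprime ?addn0 //
        pcop.
  have xx : x = x' by rewrite -(lg x y yd) -(lg x' y' yd') E.
  move/eqP: E; rewrite xx eqn_pmul2l ?expn_gt0 ?p0 // => /eqP ->; by [].
move=> x; rewrite -dvdn_divisors ?muln_gt0 ?expn_gt0 ?p0 //.
apply/idP/allpairsP => [xd|[[i d] [ie dm ->]]].
  have x0 : (0 < x)%N by rewrite (dvdn_gt0 _ xd) // muln_gt0 expn_gt0 p0.
  have [d pd xE] := pfactor_coprime pp x0.
  exists (logn p x, d); split=> /=; last by rewrite mulnC.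
    rewrite mem_index_iota ltnS /=.
    have := dvdn_leq_log p _ xd; rewrite muln_gt0 expn_gt0 p0 => /(_ m0).
    by rewrite lognM ?expn_gt0 ?p0 // pfactorK // (logn_coprime pm) addn0.
  rewrite -dvdn_divisors //.
  rewrite -(@Gauss_dvdr _ (p ^ e)) ?coprimeXr 1?coprime_sym //.
  by apply: dvdn_trans xd; rewrite [x in (_ %| x)%N]xE dvdn_mulr.
move: ie dm; rewrite mem_index_iota ltnS -dvdn_divisors //= => ie dm.
by rewrite dvdn_mul // dvdn_exp2l.
Qed.

Definition moebius n : R := \prod_(p <- primes n) (if logn p n == 1%N then -1 else 0).

Lemma moebius_le1 n : `|moebius n| <= 1.
Proof.
rewrite /moebius; elim/big_ind: _ => [|x y|p _]; first by rewrite normr1.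
  by move=> x1 y1; rewrite normrM mulr_ile1.
by case: ifP; rewrite ?normrN ?normr1 ?normr0.
Qed.

(** Together with [sum_divisors_pfactor], this is all that is used of the
    multiplicativity of the Moebius function. *)
Lemma moebius_pfactor p e m : prime p -> coprime p m -> (0 < m)%N -> (0 < e)%N ->
  moebius (p ^ e * m) = (if e == 1%N then -1 else 0) * moebius m.
Proof.
move=> pp pm m0 e0; have p0 := prime_gt0 pp.
have pe : (0 < p ^ e)%N by rewrite expn_gt0 p0.
have pNm : p \notin primes m by rewrite mem_primes pp m0 /= -prime_coprime.
rewrite /moebius (perm_big (p :: primes m)) /=; last first.
  apply: uniq_perm; rewrite ?primes_uniq //= ?pNm ?primes_uniq // => q.
  by rewrite primesM // primesX // primes_prime // !inE.
rewrite big_cons lognM // pfactorK // logn_coprime // addn0; congr (_ * _).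
rewrite big_seq [RHS]big_seq; apply: eq_bigr => q qm.
have qp : q == p = false by apply: contraNF pNm => /eqP <-.
by have -> : logn q (p ^ e * m) = logn q m by rewrite lognM // lognX logn_prime // qp muln0.
Qed.

Lemma prime_factor_split n : (1 < n)%N ->
  exists p e m, [/\ prime p, coprime p m, (0 < m < n)%N, (0 < e)%N & n = (p ^ e * m)%N].
Proof.
move=> n1; have n0 := ltnW n1; have pp := pdiv_prime n1.
have [m pm nE] := pfactor_coprime pp n0.
have e0 : (0 < logn (pdiv n) n)%N by rewrite logn_gt0 mem_primes pp n0 pdiv_dvd.
exists (pdiv n), (logn (pdiv n) n), m; split=> //; last by rewrite mulnC.
have m0 : (0 < m)%N by move: n0; rewrite {1}nE muln_gt0 => /andP[].
rewrite m0 /= [X in (_ < X)%N]nE ltn_Pmulr //.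
by rewrite -{1}(expn0 (pdiv n)) ltn_exp2l // prime_gt1.
Qed.

Lemma sum_moebius n : (0 < n)%N -> \sum_(d <- divisors n) moebius d = (n == 1%N)%:R.
Proof.
move=> n0; case: (ltngtP 1 n) => [n1|n1|<-].
- have [p [e [m [pp pm /andP[m0 _] e0 ->]]]] := prime_factor_split _ n1.
  case: e e0 => // e _; rewrite sum_divisors_pfactor //.
  rewrite big_ord_recl big_ord_recl /= [X in _ + (_ + X)]big1 => [|i _].
    rewrite addr0 -big_split /= big_seq big1 // => d dm.
    rewrite -dvdn_divisors // in dm.
    rewrite mul1n moebius_pfactor ?(dvdn_gt0 m0) //=; last exact: coprime_dvdr pm.
    by rewrite mulN1r subrr.
  rewrite big_seq big1 // => d dm.
  rewrite -dvdn_divisors // in dm.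
  by rewrite /bump /= !add1n moebius_pfactor ?(coprime_dvdr dm pm) ?(dvdn_gt0 m0 dm) //=
      mul0r.
- by move: n0; rewrite ltnNge -ltnS n1.
- by rewrite big_cons big_nil /moebius /= big_nil addr0.
Qed.

Section RealCharacterDivisorSum.
Variable chi : nat -> R.
Hypothesis chi1 : chi 1%N = 1.
Hypothesis chiM : forall m n, chi (m * n)%N = chi m * chi n.
Hypothesis chi_val : forall n, [\/ chi n = 0, chi n = 1 | chi n = -1].

Lemma geometric_sign_ge x e : [\/ x = 0, x = 1 | x = -1] ->
  (~~ odd e)%:R <= \sum_(i < e.+1) x ^+ i :> R.
Proof.
case=> -> ; last first.
- suff -> : \sum_(i < e.+1) (-1) ^+ i = (~~ odd e)%:R :> R by [].
  elim: e => [|e IH]; first by rewrite big_ord_recr big_ord0 /= add0r.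
  rewrite big_ord_recr /= IH -signr_odd /= negbK.
  by case: (odd e); rewrite /= ?expr1 ?expr0 ?subrr ?add0r.
- apply: le_trans (_ : 1 <= _); first by case: odd.
  by rewrite big_ord_recl expr0 lerDl sumr_ge0 // => i _; rewrite expr1n.
- apply: le_trans (_ : 1 <= _); first by case: odd.
  by rewrite big_ord_recl expr0 lerDl sumr_ge0 // => i _; rewrite expr0n.
Qed.

(** The sum of chi over the divisors of n is a product over the primes p of
    1 + chi p + ... + chi p ^ e. For a real character each factor is
    nonnegative, and it is at least 1 when e is even. *)
Lemma sum_divisors_character n : (0 < n)%N ->
  0 <= \sum_(d <- divisors n) chi d /\
  forall k, n = (k ^ 2)%N -> 1 <= \sum_(d <- divisors n) chi d.
Proof.
have chiX x i : chi (x ^ i)%N = chi x ^+ i.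
  by elim: i => [|i IH]; rewrite ?expn0 ?expr0 // expnS exprS chiM IH.
elim/ltn_ind: n => n IH n0; case: (ltngtP 1 n) => [n1|n1|<-]; last 1 first.
- by rewrite big_cons big_nil addr0 chi1; split=> [|_ _].
- have [p [e [m [pp pm /andP[m0 mn] e0 nE]]]] := prime_factor_split _ n1.
  have [Am0 Am1] := IH m mn m0.
  rewrite nE sum_divisors_pfactor //.
  have -> : \sum_(i < e.+1) \sum_(d <- divisors m) chi (p ^ i * d)%N =
     (\sum_(i < e.+1) chi p ^+ i) * \sum_(d <- divisors m) chi d.
    rewrite mulr_suml; apply: eq_bigr => i _; rewrite mulr_sumr.
    by apply: eq_bigr => d _; rewrite chiM chiX.
  have G := geometric_sign_ge _ e (chi_val p).
  have G0 : 0 <= \sum_(i < e.+1) chi p ^+ i by apply: le_trans G; rewrite ler0n.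
  split=> [|k kE]; first exact: mulr_ge0.
  have k0 : (0 < k)%N by case: k kE => // /esym/eqP; rewrite exp0n // -nE => /eqP nn;
      rewrite -nn in n0.
  have [j pj jE] := pfactor_coprime pp k0.
  have eE : e = (logn p k).*2.
    have := congr1 (logn p) kE.
    have pe0 : (0 < p ^ e)%N by rewrite expn_gt0 prime_gt0.
    by rewrite lognM // pfactorK // lognX (logn_coprime pm) addn0 mul2n.
  have mE : m = (j ^ 2)%N.
    move/eqP: kE; rewrite [in X in _ == X]jE expnMn -expnM muln2 -eE mulnC.
    by rewrite eqn_pmul2r ?expn_gt0 ?prime_gt0 // => /eqP.
  have := Am1 _ mE; rewrite eE odd_double /= in G * => A1.
  by rewrite -[1]mulr1 ler_pM.
- by move: n0; rewrite ltnNge -ltnS n1.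
Qed.
End RealCharacterDivisorSum.

Lemma ln_prod_nat (s : seq nat) (P : pred nat) (G : nat -> nat) :
  (forall i, P i -> (0 < G i)%N) ->
  ln (\prod_(i <- s | P i) G i)%N%:R = \sum_(i <- s | P i) ln (G i)%:R :> R.
Proof.
move=> G0; elim: s => [|i s IH]; first by rewrite !big_nil ln1.
rewrite !big_cons; case: ifP => // Pi.
by rewrite lnM_nat ?IH ?G0 // prodn_cond_gt0.
Qed.

(** The von Mangoldt function: ln p on the powers of the prime p, 0 elsewhere.
    Writing it as a sum over all candidate pairs (p, j) makes the rearrangement
    of sums over prime powers an exchange of summations. *)
Definition mangoldt n : R :=
  \sum_(1 <= p < n.+1 | prime p) \sum_(1 <= j < n.+1) (p ^ j == n)%N%:R * ln p%:R.

Lemma mangoldt_ge0 n : 0 <= mangoldt n.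
Proof.
by apply: sumr_ge0 => p _; apply: sumr_ge0 => j _; rewrite mulr_ge0 ?ler0n ?ln_nat_ge0.
Qed.

Lemma mangoldt_widen n N : (n <= N)%N -> mangoldt n =
  \sum_(1 <= p < N.+1 | prime p) \sum_(1 <= j < N.+1) (p ^ j == n)%N%:R * ln p%:R.
Proof.
elim: N => [|N IH]; first by rewrite leqn0 => /eqP ->.
rewrite leq_eqVlt => /predU1P[->//|nN]; rewrite IH //.
rewrite big_mkcond [RHS]big_mkcond /= [RHS]big_nat_recr //=.
rewrite [X in _ = _ + X](_ : _ = 0) ?addr0.
  apply: eq_big_nat => p _; case: ifP => // pp; rewrite [RHS]big_nat_recr //=.
  rewrite [X in _ = _ + X](_ : _ = 0) ?addr0 //.
  rewrite gtn_eqF ?mul0r // (leq_trans nN) //.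
  by apply: ltnW; apply: ltn_expl; exact: prime_gt1.
case: ifP => // pp; rewrite big_nat big1 // => j /andP[j1 _].
rewrite gtn_eqF ?mul0r // (leq_trans nN) //.
by rewrite -{1}(expn1 N.+1) leq_exp2l // prime_gt1.
Qed.

Lemma sum_mangoldtE F N :
  \sum_(1 <= n < N.+1) mangoldt n * F n =
  \sum_(1 <= p < N.+1 | prime p) \sum_(1 <= j < N.+1 | (p ^ j <= N)%N)
     ln p%:R * F (p ^ j)%N.
Proof.
under eq_big_nat => n /andP[_ nN] do rewrite (mangoldt_widen n N nN) mulr_suml.
rewrite exchange_big /=; apply: eq_bigr => p pp.
under eq_bigr => n _ do rewrite mulr_suml.
rewrite exchange_big /= [RHS]big_mkcond /=; apply: eq_big_nat => j /andP[j0 _].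
case: ifPn => pj.
  rewrite (bigD1_seq (p ^ j)%N) /= ?iota_uniq //; last first.
    by rewrite mem_index_iota ltnS pj andbT expn_gt0 prime_gt0.
  rewrite eqxx mul1r big1 ?addr0 // => n; rewrite eq_sym => /negPf ->.
  by rewrite !mul0r.
rewrite big_nat big1 // => n /andP[_ nN]; rewrite gtn_eqF ?mul0r //.
by rewrite ltnNge in pj *; apply: contra pj => /leq_trans; apply.
Qed.

(** The exponent of p in n is the number of powers p^j, j > 0, that divide n. *)
Lemma sum_divisors_mangoldt n : (0 < n)%N ->
  \sum_(d <- divisors n) mangoldt d = ln n%:R.
Proof.
move=> n0; rewrite sum_divisorsE // big_mkcond /=.
rewrite (eq_bigr (fun d => mangoldt d * (d %| n)%N%:R)); last first.
  by move=> d _; case: ifP; rewrite ?mulr1 ?mulr0.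
rewrite sum_mangoldtE.
transitivity (\sum_(1 <= p < n.+1 | prime p) ln (p ^ logn p n)%N%:R : R).
  rewrite big_nat_cond [RHS]big_nat_cond; apply: eq_bigr => p /andP[/andP[p0 _] pp].
  rewrite natrX lnXn ?ltr0n //.
  have -> : ln p%:R *+ logn p n = \sum_(1 <= j < (logn p n).+1) ln p%:R :> R.
    by rewrite sumr_const_nat subn1.
  rewrite [RHS](@big_nat_widen _ _ _ _ _ n.+1); last exact: leqW (ltn_logl _ n0).
  rewrite [LHS]big_mkcond [RHS]big_mkcond; apply: eq_bigr.
  move=> j _; rewrite pfactor_dvdn // ltnS.
  case: (leqP j (logn p n)) => jl; rewrite ?mulr1 ?mulr0 ?if_same //.
  by rewrite (leq_trans _ (dvdn_leq n0 (pfactor_dvdnn p n))) // leq_pexp2l.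
rewrite -[in RHS](partnT n0) /partn ln_prod_nat => [|p _]; last first.
  by case: p => [|p]; [rewrite lognE|rewrite expn_gt0].
rewrite [RHS]big_ltn_cond //= lognE /= expn0 ln1 add0r.
rewrite [LHS]big_mkcond [RHS]big_mkcond; apply: eq_big_nat => p _ /=;
    case: ifPn => // /negPf pp.
by rewrite lognE pp expn0 ln1.
Qed.

End DivisorSums.

(** * Estimates of Chebyshev and Mertens *)

Section Chebyshev.
Variable R : realType.
Implicit Types (n m p e N : nat).
Local Notation mangoldt := (mangoldt R).

Definition chebyshev_psi N : R := \sum_(1 <= n < N.+1) mangoldt n.

Lemma chebyshev_psiE n N : (n <= N)%N ->
  chebyshev_psi n = \sum_(1 <= d < N.+1) mangoldt d * (d <= n)%N%:R.
Proof.
move=> nN; rewrite /chebyshev_psi (@big_nat_widen _ _ _ _ _ N.+1) // big_mkcond /=.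
by apply: eq_bigr => d _; rewrite ltnS; case: leqP; rewrite ?mulr1 ?mulr0.
Qed.

(** Legendre's formula: sum ln n = sum of [mangoldt d] over d | n, and exchange.
    The summation range is left free above n so that the formulas for n and 2n
    can be compared term by term. *)
Lemma ln_fact_mangoldt n N : (n <= N)%N ->
  ln n`!%:R = \sum_(1 <= d < N.+1) mangoldt d * (n %/ d)%:R.
Proof.
move=> nN; rewrite ln_fact_sum.
transitivity (\sum_(1 <= k < n.+1) \sum_(d <- divisors k) mangoldt d).
  by apply: eq_big_nat => k /andP[k0 _]; rewrite sum_divisors_mangoldt.
rewrite (sum_divisors_swap R (fun d _ => mangoldt d)).
rewrite (@big_nat_widen _ _ _ _ _ N.+1) // big_mkcond /=;
    apply: eq_big_nat => d /andP[d0 _].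
rewrite ltnS; case: leqP => dn; last by rewrite divn_small // mulr0.
by rewrite sumr_const_nat subn1 mulr_natr.
Qed.

Lemma fact_double_le n : (n.*2`! <= 4 ^ n * n`! ^ 2)%N.
Proof.
elim: n => [|n IH] //.
rewrite doubleS !factS expnS expnMn.
have -> : (4 * 4 ^ n * (n.+1 ^ 2 * n`! ^ 2) = (4 * n.+1 ^ 2) * (4 ^ n * n`! ^ 2))%N by ring.
rewrite mulnA leq_mul //; lia.
Qed.

(** Chebyshev's argument: floor (2n/d) - 2 floor (n/d) is nonnegative, and equal to
    1 for n < d <= 2n, so that psi (2n) - psi n is at most the logarithm of the
    central binomial coefficient, which is at most 2n ln 2. *)
Lemma chebyshev_psi_double n : chebyshev_psi n.*2 <= chebyshev_psi n + n.*2%:R.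
Proof.
have nn : (n <= n.*2)%N by rewrite -addnn leq_addr.
have ln2 : ln 2 <= 1 :> R by apply: (@le_ln1Dx R 1); lra.
have H : ln n.*2`!%:R - 2 * ln n`!%:R <= n.*2%:R :> R.
  have : ln n.*2`!%:R <= ln (4 ^ n * n`! ^ 2)%N%:R :> R.
    by apply: ler_ln_nat; rewrite ?fact_gt0 ?fact_double_le.
  rewrite lnM_nat ?expn_gt0 ?fact_gt0 // !natrX !lnXn ?ltr0n ?fact_gt0 //.
  have -> : ln 4 = 2 * ln 2 :> R by rewrite (lnM_nat R 2 2) // mulr_natl mulr2n.
  rewrite -[_ *+ n]mulr_natr -[ln n`!%:R *+ 2]mulr_natr.
  have -> : n.*2%:R = 2 * n%:R :> R by rewrite -mul2n natrM.
  have n0 : 0 <= n%:R :> R by rewrite ler0n.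
  have := ler_wpM2l n0 ln2; lra.
suff : chebyshev_psi n.*2 + 2 * ln n`!%:R <= chebyshev_psi n + ln n.*2`!%:R by lra.
rewrite (chebyshev_psiE _ _ (leqnn n.*2)) (chebyshev_psiE _ _ nn) !(ln_fact_mangoldt _
    n.*2) //.
rewrite mulr_sumr -!big_split /=; apply: ler_sum_nat => d /andP[d0 dn].
rewrite mulrCA -!mulrDr; apply: ler_wpM2l; first exact: mangoldt_ge0.
rewrite -natrM -!natrD ler_nat -[(d <= n.*2)%N]ltnS dn /=.
have dn2 : (2 * (n %/ d) <= n.*2 %/ d)%N.
  by rewrite leq_divRL // -mulnA -mul2n leq_mul2l leq_divM.
case: (leqP d n) => nd /=; first by rewrite leq_add2l.
by rewrite (divn_small nd) muln0 addn0 add0n divn_gt0.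
Qed.

Lemma mangoldt_le_ln n : (0 < n)%N -> mangoldt n <= ln n%:R.
Proof.
move=> n0; rewrite -sum_divisors_mangoldt //.
rewrite (bigD1_seq n) ?divisors_uniq -?dvdn_divisors //= lerDl sumr_ge0 // => d _.
exact: mangoldt_ge0.
Qed.

(** Halving N costs at most N by [chebyshev_psi_double]; the constant 4 leaves room for
    the extra term ln N at odd N. *)
Lemma chebyshev N : chebyshev_psi N <= 4 * N%:R.
Proof.
elim/ltn_ind: N => N IH.
case: (posnP N) => [->|N0]; first by rewrite /chebyshev_psi big_geq // mulr0.
have h : (N./2 < N)%N by lia.
have H := chebyshev_psi_double N./2; have IH' := IH _ h.
have [oN|eN] := boolP (odd N); last first.
  have NE : N./2.*2 = N by rewrite even_halfK.
  have NR : N%:R = 2 * N./2%:R :> R by rewrite -natrM mul2n NE.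
  rewrite NE in H; have n0 : 0 <= N./2%:R :> R by rewrite ler0n.
  rewrite NR in H *; lra.
have NE : N = N./2.*2.+1 by rewrite -[in LHS](odd_double_half N) oN add1n.
rewrite NE /chebyshev_psi big_nat_recr //= -/(chebyshev_psi _).
have L : mangoldt N./2.*2.+1 <= N./2.*2%:R.
  apply: le_trans (mangoldt_le_ln _ _) _ => //.
  by rewrite -natr1 addrC; apply: le_ln1Dx; rewrite (lt_le_trans (ltrN10 _)) // ler0n.
have n0 : 0 <= N./2%:R :> R by rewrite ler0n.
have NR : N./2.*2%:R = 2 * N./2%:R :> R by rewrite -natrM mul2n.
have NR1 : N./2.*2.+1%:R = 2 * N./2%:R + 1 :> R by rewrite -NR natr1.
rewrite NR1; rewrite NR in H L; lra.
Qed.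

(** Compare N/d with its floor in Legendre's formula: the total error is at most
    psi N, hence O(N), while ln N! = N ln N + O(N). *)
Lemma mertens N : (0 < N)%N ->
  `|\sum_(1 <= d < N.+1) mangoldt d / d%:R - ln N%:R| <= 4.
Proof.
move=> N0; have n0 : 0 < N%:R :> R by rewrite ltr0n.
have E := ln_fact_mangoldt _ _ (leqnn N).
set M := \sum_(_ <= _ < _) _.
have ME : N%:R * M = \sum_(1 <= d < N.+1) mangoldt d * (N%:R / d%:R).
  by rewrite mulr_sumr; apply: eq_bigr => d _; rewrite mulrCA.
have lo : ln N`!%:R <= N%:R * M.
  rewrite E ME; apply: ler_sum_nat => d /andP[d0 _].
  apply: ler_wpM2l; first exact: mangoldt_ge0.
  by rewrite ler_pdivlMr ?ltr0n // -natrM ler_nat leq_divM.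
have hi : N%:R * M <= ln N`!%:R + chebyshev_psi N.
  rewrite E ME /chebyshev_psi -big_split /=; apply: ler_sum_nat => d /andP[d0 _].
  rewrite -[X in _ <= _ + X]mulr1 -mulrDr natr1; apply: ler_wpM2l;
      first exact: mangoldt_ge0.
  by rewrite ler_pdivrMr ?ltr0n // -natrM ler_nat ltnW // ltn_ceil.
have := chebyshev N; have := ln_fact_le R N; have := ln_fact_ge R N => h1 h2 h3.
have H1 : N%:R * (M - ln N%:R) <= N%:R * 4 by lra.
have H2 : N%:R * (- 4) <= N%:R * (M - ln N%:R) by lra.
by rewrite ler_norml -(ler_pM2l n0) H2 -(ler_pM2l n0).
Qed.

(** Each term is at most the decrement of the sequence (1 + ln n) / n at n. *)
Lemma sum_ln_div_succ N : \sum_(1 <= n < N.+1) ln n%:R / (n%:R * n.+1%:R) <= 1 :> R.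
Proof.
suff : \sum_(1 <= n < N.+1) ln n%:R / (n%:R * n.+1%:R) <= 1 - (1 + ln N.+1%:R) / N.+1%:R
    :> R.
  move/le_trans; apply; rewrite gerBl divr_ge0 ?addr_ge0 ?ln_nat_ge0 //.
elim: N => [|N IH]; first by rewrite big_geq // ln1 addr0 divr1 subrr.
rewrite big_nat_recr //=; apply: le_trans (lerD IH (lexx _)) _.
have a0 : 0 < N.+1%:R :> R by rewrite ltr0n.
have H := ln_natS_sub R _ (ltn0Sn N); move: H.
have -> : N.+2%:R = N.+1%:R + 1 :> R by rewrite natr1.
set a := N.+1%:R in a0 *; set x := ln a; set y := ln (a + 1) => H.
rewrite -subr_ge0.
have -> : 1 - (1 + y) / (a + 1) - (1 - (1 + x) / a + x / (a * (a + 1))) =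
  (a^-1 - (y - x)) / (a + 1) by field; lra.
by rewrite divr_ge0 ?subr_ge0 // addr_ge0 // ltW.
Qed.

Lemma geometric_tail_le (x : R) N : 0 <= x <= 2^-1 ->
  \sum_(2 <= j < N) x ^+ j <= 2 * x ^+ 2.
Proof.
move=> /andP[x0 x2].
case: (leqP N 2) => [N2|/ltnW N2]; first by rewrite big_geq // mulr_ge0 // exprn_ge0.
suff : \sum_(2 <= j < N) x ^+ j <= 2 * x ^+ 2 - 2 * x ^+ N.
  by move/le_trans; apply; rewrite gerBl mulr_ge0 // exprn_ge0.
elim: N N2 => // N IH; rewrite leq_eqVlt => /predU1P[<-|N2];
    first by rewrite big_geq // subrr.
rewrite big_nat_recr //; apply: le_trans (lerD (IH N2) (lexx _)) _.
have : 0 <= x ^+ N by rewrite exprn_ge0.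
move/(ler_wpM2r)/(_ _ _ x2); rewrite [x ^+ N.+1]exprS.
by set y := x ^+ N; set z := x ^+ 2; lra.
Qed.

(** Proper prime powers contribute at most the sum over p of 2 ln p / p^2, a convergent
    series; since 2 / p^2 <= 3 / (p (p + 1)) it is controlled by
    [sum_ln_div_succ]. *)
Lemma sum_mangoldt_nonprime_le N :
  \sum_(1 <= n < N.+1) mangoldt n * ((~~ prime n)%:R / n%:R) <= 3.
Proof.
rewrite sum_mangoldtE.
apply: le_trans (_ : 3 * \sum_(1 <= n < N.+1) ln n%:R / (n%:R * n.+1%:R) <= _); last first.
  by have := sum_ln_div_succ N; lra.
rewrite mulr_sumr big_mkcond /=; apply: ler_sum_nat => p /andP[p0 _].
case: ifPn => pp; last by rewrite mulr_ge0 // divr_ge0 ?ln_nat_ge0 // mulr_ge0.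
have p2 := prime_gt1 pp.
case: (posnP N) => [->|N0]; first by rewrite big_geq // mulr_ge0 // divr_ge0 ?ln_nat_ge0
    // mulr_ge0.
rewrite big_mkcond /= big_ltn // expn1 pp /= mul0r mulr0 if_same add0r.
apply: le_trans (_ : \sum_(2 <= j < N.+1) ln p%:R * p%:R^-1 ^+ j <= _).
  apply: ler_sum_nat => j /andP[j2 _]; case: ifP => _;
      last by rewrite mulr_ge0 ?ln_nat_ge0 ?exprn_ge0 ?invr_ge0.
  apply: ler_wpM2l; first exact: ln_nat_ge0.
  rewrite natrX -exprVn; apply: ler_piMl; rewrite ?exprn_ge0 ?invr_ge0 //.
  by case: prime.
have pr : 2 <= p%:R :> R by rewrite ler_nat.
rewrite -mulr_sumr mulrCA; apply: ler_wpM2l; first exact: ln_nat_ge0.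
apply: le_trans (geometric_tail_le _ _ _) _.
  by rewrite invr_ge0 ler0n /= lef_pV2 ?posrE; lra.
rewrite -[p.+1%:R]natr1 -subr_ge0.
have -> : 3 / (p%:R * (p%:R + 1)) - 2 * p%:R^-1 ^+ 2 = (p%:R - 2) / (p%:R ^+ 2 * (p%:R +
    1)) :> R.
  by field; lra.
by rewrite divr_ge0 ?mulr_ge0 ?exprn_ge0 //; lra.
Qed.

(** Up to O(1), the sum of [mangoldt n / n] is carried by the primes prime to k: the
    proper powers are controlled by the previous lemma, and the primes dividing k
    are at most k. *)
Lemma sum_mangoldt_exceptions_bounded k : (0 < k)%N -> exists B, forall N,
  \sum_(1 <= n < N.+1) mangoldt n * ((~~ (prime n && coprime k n))%:R / n%:R) <= B.
Proof.
move=> k0; exists (3 + \sum_(1 <= n < k.+1) mangoldt n / n%:R) => N.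
pose M := maxn N k.
have H : \sum_(1 <= n < M.+1 | (n < k.+1)%N) mangoldt n / n%:R =
   \sum_(1 <= n < k.+1) mangoldt n / n%:R.
  by rewrite [RHS](@big_nat_widen _ _ _ _ _ M.+1) // ltnS leq_maxr.
apply: le_trans (_ : \sum_(1 <= n < M.+1) mangoldt n * ((~~ (prime n && coprime k n))%:R
    / n%:R) <= _).
  rewrite [leRHS](@big_cat_nat _ _ _ N.+1) //= ?ltnS ?leq_maxl // lerDl.
  by apply: sumr_ge0 => n _; rewrite mulr_ge0 ?mangoldt_ge0 // divr_ge0.
apply: le_trans (lerD (sum_mangoldt_nonprime_le M) (lexx _)).
rewrite -H [X in _ <= _ + X]big_mkcond -big_split /=; apply: ler_sum_nat => n /andP[n0 _].
have g0 : 0 <= mangoldt n / n%:R by rewrite divr_ge0 ?mangoldt_ge0.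
have E (b : bool) : mangoldt n * (b%:R / n%:R) = b%:R * (mangoldt n / n%:R) by rewrite
    mulrCA.
rewrite !E; case: (boolP (prime n)) => pn /=; last by rewrite mul1r lerDl; case: ifP.
rewrite mul0r add0r ltnS; case: leqP => nk.
  by apply: ler_piMl => //; case: coprime.
rewrite coprime_sym prime_coprime // gtnNdvd // mul0r; exact: lexx.
Qed.
End Chebyshev.

(** * Moebius inversion *)

Section MoebiusInversion.
Variable R : realType.
Local Notation mangoldt := (mangoldt R).
Local Notation moebius := (moebius R).

Lemma divn_dvd_gt0 d n : (0 < n)%N -> (d %| n)%N -> (0 < n %/ d)%N.
Proof. by move=> n0 dn; rewrite divn_gt0 ?(dvdn_gt0 n0 dn) // (dvdn_leq n0 dn). Qed.

(** The right-hand side depends on the pair (d, e) through d e only, so that the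
    order of a double sum over divisors can be exchanged. *)
Lemma sum_divisor_pairs (H : nat -> nat -> R) n : (0 < n)%N ->
  \sum_(d <- divisors n) \sum_(e <- divisors (n %/ d)) H d e =
  \sum_(1 <= d < n.+1) \sum_(1 <= e < n.+1) (if (d * e %| n)%N then H d e else 0).
Proof.
move=> n0; rewrite (sum_divisorsE R (fun d => \sum_(e <- divisors (n %/ d)) H d e)) //.
rewrite big_mkcond; apply: eq_big_nat => d /andP[d0 _].
case: ifPn => dn; last first.
  rewrite big1 // => e _; case: ifP => // den.
  by rewrite (dvdn_trans (dvdn_mulr e (dvdnn d)) den) in dn.
have nd0 := divn_dvd_gt0 _ _ n0 dn.
rewrite (sum_divisorsE R) //.
rewrite (@big_nat_widen _ _ _ _ _ n.+1) ?ltnS ?leq_div // big_mkcond.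
apply: eq_big_nat => e _; rewrite ltnS.
rewrite -{3}(divnK dn) [(_ * d)%N]mulnC dvdn_pmul2l //.
by case: (boolP (e %| _)%N) => //= en; rewrite (dvdn_leq _ en).
Qed.

(** Moebius inversion of [sum_divisors_mangoldt]. *)
Lemma moebius_ln n : (0 < n)%N ->
  \sum_(d <- divisors n) moebius d * (ln n%:R - ln d%:R) = mangoldt n.
Proof.
move=> n0.
transitivity (\sum_(d <- divisors n) \sum_(e <- divisors (n %/ d)) moebius d * mangoldt e).
  rewrite big_seq [RHS]big_seq; apply: eq_bigr => d; rewrite -dvdn_divisors // => dn.
  have nd0 := divn_dvd_gt0 _ _ n0 dn.
  rewrite -mulr_sumr sum_divisors_mangoldt //; congr (_ * _).
  have E : ln n%:R = ln (n %/ d)%:R + ln d%:R :> R.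
    by rewrite -lnM_nat ?divnK // (dvdn_gt0 n0 dn).
  by rewrite E addrK.
rewrite (sum_divisor_pairs (fun d e => moebius d * mangoldt e)) // exchange_big /=.
have -> : \sum_(1 <= e < n.+1) \sum_(1 <= d < n.+1)
     (if (d * e %| n)%N then moebius d * mangoldt e else 0) =
   \sum_(1 <= e < n.+1) \sum_(1 <= d < n.+1)
     (if (e * d %| n)%N then moebius d * mangoldt e else 0).
  by apply: eq_bigr => e _; apply: eq_bigr => d _; rewrite mulnC.
rewrite -(sum_divisor_pairs (fun e d => moebius d * mangoldt e)) //.
rewrite (bigD1_seq n) ?divisors_uniq -?dvdn_divisors //= [X in _ + X]big_seq_cond [X in _
    + X]big1 ?addr0.
  by rewrite -mulr_suml divnn n0 sum_moebius // eqxx mul1r.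
move=> d /andP[]; rewrite -dvdn_divisors // => dn dNn.
have nd0 := divn_dvd_gt0 _ _ n0 dn.
rewrite -mulr_suml sum_moebius // (_ : _ == _ = false) ?mul0r //.
by apply: contraNF dNn => /eqP E; rewrite -(divnK dn) E mul1n.
Qed.
End MoebiusInversion.

(** * Twisted harmonic sums modulo k *)

Section Periodic.
Variables (R : realType) (k : nat).
Hypothesis k1 : (1 < k)%N.
Implicit Types (phi f : 'Z_k -> R) (g r : 'Z_k).

Lemma sum_full_period phi : \sum_(0 <= i < k) phi i%:R = \sum_r phi r.
Proof.
have H m : m = k -> \sum_(0 <= i < k) phi i%:R = \sum_(0 <= i < m) phi i%:R by move=> ->.
rewrite (H _ (Zp_cast k1)) big_mkord; apply: eq_bigr => i _.
by rewrite natr_Zp.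
Qed.

(** A full period contributes 0, so that only the incomplete last period remains. *)
Lemma periodic_partial_sum phi : \sum_r phi r = 0 ->
  forall n, `|\sum_(0 <= i < n) phi i%:R| <= \sum_r `|phi r|.
Proof.
move=> phi0; elim/ltn_ind => n IH.
have [nk|kn] := ltnP n k.
  rewrite -(sum_full_period (fun r => `|phi r|)).
  rewrite (@big_cat_nat _ _ _ n 0 k) //=; last exact: ltnW.
  apply: le_trans (ler_norm_sum _ _ _) _; rewrite lerDl sumr_ge0 // => i _.
rewrite (@big_cat_nat _ _ _ k 0 n) //= sum_full_period phi0 add0r.
rewrite -{1}(add0n k) big_addn.
rewrite (eq_bigr (fun i => phi i%:R)) => [|i _]; last by rewrite natrD pchar_Zp // addr0.
by apply: IH; lia.
Qed.

Lemma periodic_tail_bound phi (w : nat -> R) a : \sum_r phi r = 0 ->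
  (forall n, (a <= n)%N -> 0 <= w n) ->
  (forall n, (a <= n)%N -> w n.+1 <= w n) ->
  forall b, `|\sum_(a <= n < b) phi n%:R * w n| <= (\sum_r `|phi r|) * w a *+ 2.
Proof.
by move=> phi0 w0 wdec b; apply: abel_bound w0 wdec; apply: periodic_partial_sum.
Qed.

Lemma periodic_limit phi (w : nat -> R) : \sum_r phi r = 0 ->
  (forall n, (1 <= n)%N -> 0 <= w n) ->
  (forall n, (1 <= n)%N -> w n.+1 <= w n) ->
  exists C, forall N, `|\sum_(1 <= n < N.+1) phi n%:R * w n - C| <=
    (\sum_r `|phi r|) * w N.+1 *+ 2.
Proof.
move=> phi0 w0 wdec.
apply: (limit_with_rate _ (fun N => \sum_(1 <= n < N.+1) phi n%:R * w n)) => N M NM.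
rewrite (@big_cat_nat _ _ _ N.+1 1 M.+1) //= addrAC subrr add0r.
apply: periodic_tail_bound => // n Nn; [apply: w0|apply: wdec]; exact: leq_trans Nn.
Qed.

(** The twisted harmonic sum of a mean-zero function converges, with error O(1/N), to a
    linear functional of the function. The constants [C r] are the limits for the
    indicators of the classes r, corrected by a constant to have mean zero. *)
Lemma harmonic_constants : exists (C : 'Z_k -> R) (K : R), 0 <= K /\
  forall phi, \sum_r phi r = 0 -> forall N,
  `|\sum_(1 <= n < N.+1) phi n%:R / n%:R - \sum_r C r * phi r| <=
     K * (\sum_r `|phi r|) / N.+1%:R.
Proof.
pose q : R := #|'Z_k|%:R^-1.
(* The indicator of the class r, centered. *)
pose dl (r s : 'Z_k) : R := (s == r)%:R - q.
have q0 : #|'Z_k|%:R != 0 :> R by rewrite pnatr_eq0 -lt0n; apply/card_gt0P; exists 0.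
have dl0 r : \sum_s dl r s = 0.
  rewrite sumrB sumr_const -mulr_natl divff // (bigD1 r) //= eqxx big1 ?addr0 ?subrr //.
  by move=> s /negPf ->.
have : forall r, exists c, forall N, `|\sum_(1 <= n < N.+1) dl r n%:R * n%:R^-1 - c| <=
    (\sum_s `|dl r s|) * N.+1%:R^-1 *+ 2.
  move=> r; apply: (periodic_limit (dl r) (fun n => n%:R^-1)) => [|n n0|n n0] /=.
  - exact: dl0.
  - by rewrite invr_ge0.
  - by rewrite lef_pV2 ?posrE ?ltr0n // ler_nat.
move/fin_all_exists => [C HC]; exists C.
pose K := \sum_r (\sum_s `|dl r s|) *+ 2.
have B0 r : 0 <= (\sum_s `|dl r s|) *+ 2 by rewrite mulrn_wge0 // sumr_ge0.
have KB r : (\sum_s `|dl r s|) *+ 2 <= K.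
  by rewrite /K [leRHS](bigD1 r) //= lerDl sumr_ge0.
exists K; split; first exact: sumr_ge0.
move=> phi phi0 N.
have E n : phi n%:R = \sum_r phi r * dl r n%:R.
  under eq_bigr do rewrite mulrBr.
  rewrite sumrB -mulr_suml phi0 mul0r subr0 (bigD1 n%:R) //= eqxx mulr1 big1 ?addr0 //.
  by move=> r; rewrite eq_sym => /negPf ->; rewrite mulr0.
have -> : \sum_(1 <= n < N.+1) phi n%:R / n%:R - \sum_r C r * phi r =
  \sum_r phi r * (\sum_(1 <= n < N.+1) dl r n%:R * n%:R^-1 - C r).
  under [RHS]eq_bigr do rewrite mulrBr mulr_sumr.
  rewrite sumrB; congr (_ - _); last by apply: eq_bigr => r _; rewrite mulrC.
  rewrite exchange_big /=; apply: eq_bigr => n _; rewrite E mulr_suml.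
  by apply: eq_bigr => r _; rewrite mulrA.
apply: le_trans (ler_norm_sum _ _ _) _; rewrite mulrAC mulr_sumr.
apply: ler_sum => r _; rewrite normrM mulrC; apply: ler_wpM2r => //.
apply: le_trans (HC r N) _; rewrite -mulrnAl.
by apply: ler_wpM2r; [rewrite invr_ge0|exact: KB].
Qed.

(** Functions on the unit group of Z/k are encoded as functions on Z/k that vanish off
    the units: [n |-> f n%:R] is then the usual extension by 0 to the integers,
    and the values at multiples of a non-unit vanish without case analysis. *)
Definition unit_supported f := forall r, r \isn't a GRing.unit -> f r = 0.

Lemma sum_translate f g : unit_supported f -> g \is a GRing.unit ->
  \sum_r f (g * r) = \sum_r f r.
Proof.
by move=> fU gU; rewrite [RHS](reindex_inj (mulrI gU)).
Qed.

Lemma translate_nonunit f g r : unit_supported f -> g \isn't a GRing.unit -> f (g * r) = 0.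
Proof. by move=> fU gN; apply: fU; rewrite unitrM negb_and gN. Qed.

Lemma sum_translate0 f g : unit_supported f -> \sum_r f r = 0 -> \sum_r f (g * r) = 0.
Proof.
move=> fU f0; have [gU|gN] := boolP (g \is a GRing.unit); first by rewrite sum_translate.
by rewrite big1 // => r _; apply: translate_nonunit.
Qed.

Lemma sum_translate_norm f g : unit_supported f -> \sum_r `|f (g * r)| <= \sum_r `|f r|.
Proof.
move=> fU; have fU' : unit_supported (fun r => `|f r|) by move=> r /fU ->; rewrite normr0.
have [gU|gN] := boolP (g \is a GRing.unit); first by rewrite (sum_translate _ _ fU').
by rewrite big1 ?sumr_ge0 // => r _; apply: (translate_nonunit _ _ _ fU').
Qed.

Local Notation mangoldt := (mangoldt R).
Local Notation moebius := (moebius R).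

(** The operator T_N of the outline above; the unit group acts on functions by the
    translations [f |-> f (g * _)]. *)
Definition prime_sum (N : nat) f g : R :=
  \sum_(1 <= n < N.+1) mangoldt n / n%:R * f (g * n%:R).

Section HarmonicOperator.
Variables (C : 'Z_k -> R) (K : R).
Hypothesis K0 : 0 <= K.
Hypothesis CK : forall phi, \sum_r phi r = 0 -> forall N,
  `|\sum_(1 <= n < N.+1) phi n%:R / n%:R - \sum_r C r * phi r| <=
     K * (\sum_r `|phi r|) / N.+1%:R.

(** The operator L of the outline above: by [harmonic_rate], [harmonic_op f g] is the
    sum of the series [f (g * n%:R) / n%:R] when [f] has mean zero. *)
Definition harmonic_op f g : R := \sum_r C r * f (g * r).

Lemma inv_floor_le d N : (0 < d)%N -> (0 < N)%N ->
  (d%:R * (N %/ d).+1%:R)^-1 <= N%:R^-1 :> R.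
Proof.
move=> d0 N0; rewrite lef_pV2 ?posrE ?mulr_gt0 ?ltr0n // -natrM ler_nat mulnC.
exact: ltnW (ltn_ceil _ _).
Qed.

Lemma harmonic_rate f g N : unit_supported f -> \sum_r f r = 0 ->
  `|\sum_(1 <= n < N.+1) f (g * n%:R) / n%:R - harmonic_op f g| <=
  K * (\sum_r `|f r|) / N.+1%:R.
Proof.
move=> fU f0; apply: le_trans (CK (fun r => f (g * r)) (sum_translate0 _ g fU f0) N) _.
rewrite -!mulrA; apply: ler_wpM2l => //; apply: ler_wpM2r; first by rewrite invr_ge0.
exact: sum_translate_norm.
Qed.

(** The sum of f over multiples d m factors through translation by d: this is how a
    Dirichlet convolution turns into a composition of operators. *)
Lemma sum_twisted_convolution (u : nat -> R) f g N :
  \sum_(1 <= n < N.+1) (\sum_(d <- divisors n) u d) * (f (g * n%:R) / n%:R) =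
  \sum_(1 <= d < N.+1) u d / d%:R *
     \sum_(1 <= m < (N %/ d).+1) f (g * d%:R * m%:R) / m%:R.
Proof.
pose F d m := u d * (f (g * (d * m)%:R) / (d * m)%:R).
transitivity (\sum_(1 <= n < N.+1) \sum_(d <- divisors n) F d (n %/ d)%N).
  apply: eq_big_nat => n /andP[n0 _]; rewrite mulr_suml big_seq [RHS]big_seq.
  apply: eq_bigr => d; rewrite -dvdn_divisors // => dn.
  by rewrite /F mulnC divnK.
rewrite sum_divisors_swap; apply: eq_bigr => d _; rewrite mulr_sumr.
apply: eq_bigr => m _; rewrite /F.
have -> : g * (d * m)%:R = g * d%:R * m%:R by rewrite natrM mulrA.
by rewrite natrM invfM; ring.
Qed.

(** Twist the identity ln = 1 * mangoldt. The left side gives the sum of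
    [f (g n) ln n / n], bounded by Abel summation. The right side gives
    [prime_sum] applied to [harmonic_op f], up to the errors O(1/N) of the inner
    sums weighted by [mangoldt], hence up to O(psi N / N) = O(1). *)
Lemma prime_sum_image f g : unit_supported f -> \sum_r f r = 0 ->
  exists B, forall N, (0 < N)%N -> `|prime_sum N (harmonic_op f) g| <= B.
Proof.
move=> fU f0; pose A := \sum_r `|f r|.
have A0 : 0 <= A by apply: sumr_ge0.
pose w (n : nat) : R := ln n%:R / n%:R.
have w0 n : 0 <= w n by rewrite divr_ge0 ?ln_nat_ge0.
(* The weight ln n / n is monotone from 4 on only. *)
pose B1 := \sum_(1 <= n < 4) `|f (g * n%:R) * w n| + (\sum_r `|f (g * r)|) * w 4 *+ 2.
have H1 N : `|\sum_(1 <= n < N.+1) f (g * n%:R) * w n| <= B1.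
  have [N4|N4] := leqP N.+1 4.
    apply: le_trans (ler_norm_sum _ _ _) _.
    rewrite /B1 (@big_cat_nat _ _ _ N.+1 1 4) //= -addrA lerDl addr_ge0 ?sumr_ge0 //.
    by rewrite mulrn_wge0 // mulr_ge0 // sumr_ge0.
  rewrite (@big_cat_nat _ _ _ 4 1 N.+1) //=; last exact: ltnW.
  apply: le_trans (ler_normD _ _) (lerD (ler_norm_sum _ _ _) _).
  apply: (periodic_tail_bound (fun r => f (g * r))) => // [|n n4].
    exact: sum_translate0.
  exact: ln_div_antitone.
exists (B1 + 4 * (K * A)) => N N0.
pose S d := \sum_(1 <= m < (N %/ d).+1) f (g * d%:R * m%:R) / m%:R.
have E : \sum_(1 <= n < N.+1) f (g * n%:R) * w n =
  \sum_(1 <= d < N.+1) mangoldt d / d%:R * S d.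
  rewrite -sum_twisted_convolution; apply: eq_big_nat => n /andP[n0 _].
  by rewrite sum_divisors_mangoldt // /w mulrCA.
have -> : prime_sum N (harmonic_op f) g =
   \sum_(1 <= n < N.+1) f (g * n%:R) * w n -
   \sum_(1 <= d < N.+1) mangoldt d / d%:R * (S d - harmonic_op f (g * d%:R)).
  by rewrite E -sumrB; apply: eq_bigr => d _; ring.
apply: le_trans (ler_normB _ _) (lerD (H1 N) _).
apply: le_trans (_ : (K * A) / N%:R * chebyshev_psi R N <= _); last first.
  rewrite mulrAC ler_pdivrMr ?ltr0n // mulrC.
  have := ler_wpM2r (mulr_ge0 K0 A0) (chebyshev R N); lra.
apply: le_trans (ler_norm_sum _ _ _) _; rewrite mulr_sumr;
    apply: ler_sum_nat => d /andP[d0 _].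
rewrite normrM ger0_norm ?divr_ge0 ?mangoldt_ge0 //.
apply: le_trans (ler_wpM2l _ (harmonic_rate _ _ _ fU f0)) _;
    first by rewrite divr_ge0 ?mangoldt_ge0.
rewrite mulrACA -invfM -mulrA mulrC; apply: ler_wpM2r; first exact: mangoldt_ge0.
by apply: ler_wpM2l; [exact: mulr_ge0|exact: inv_floor_le].
Qed.

(** Twist the identity
      mangoldt n + [n = 1] ln N = sum of moebius d (ln N - ln d) over d | n.
    The left side gives T_N f + f ln N. On the right side every inner sum is, up
    to sign, a tail of a series with sum 0, so that the total is
    O((1/N) sum of (ln N - ln d) over d <= N) = O(1). *)
Lemma prime_sum_kernel f g : unit_supported f -> \sum_r f r = 0 ->
  (forall r, harmonic_op f r = 0) ->
  exists B, forall N, (0 < N)%N -> `|prime_sum N f g + f g * ln N%:R| <= B.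
Proof.
move=> fU f0 Lf; pose A := \sum_r `|f r|.
have A0 : 0 <= A by apply: sumr_ge0.
exists (K * A) => N N0.
have -> : prime_sum N f g + f g * ln N%:R =
  \sum_(1 <= d < N.+1) moebius d * (ln N%:R - ln d%:R) / d%:R *
     \sum_(1 <= m < (N %/ d).+1) f (g * d%:R * m%:R) / m%:R.
  rewrite -sum_twisted_convolution.
  rewrite [X in _ + X](_ : _ = \sum_(1 <= n < N.+1)
      (ln N%:R * (n == 1%N)%:R) * (f (g * n%:R) / n%:R)); last first.
    rewrite big_ltn // big_nat big1 ?addr0 => [|n /andP[n2 _]].
      by rewrite eqxx !mulr1 divr1 mulrC.
    by rewrite gtn_eqF // mulr0 mul0r.
  rewrite -big_split /=; apply: eq_big_nat => n /andP[n0 _].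
  suff -> : \sum_(d <- divisors n) moebius d * (ln N%:R - ln d%:R) =
      mangoldt n + ln N%:R * (n == 1%N)%:R by ring.
  have -> : ln N%:R * (n == 1%N)%:R = (ln N%:R - ln n%:R) * (n == 1%N)%:R :> R.
    by case: eqP => [->|_]; rewrite ?mulr0 // ln1 subr0.
  rewrite -moebius_ln // -sum_moebius // mulr_sumr -big_split /=.
  by apply: eq_bigr => d _; ring.
apply: le_trans (ler_norm_sum _ _ _) _.
apply: le_trans (_ : (K * A) / N%:R * \sum_(1 <= d < N.+1) (ln N%:R - ln d%:R) <= _);
    last first.
  rewrite mulrAC ler_pdivrMr ?ltr0n //; apply: ler_wpM2l; first exact: mulr_ge0.
  exact: sum_ln_ratio_le.
rewrite mulr_sumr; apply: ler_sum_nat => d /andP[d0 dN].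
have l0 : 0 <= ln N%:R - ln d%:R :> R by rewrite subr_ge0 ler_ln_nat.
have H : `|\sum_(1 <= m < (N %/ d).+1) f (g * d%:R * m%:R) / m%:R| <=
   K * A / (N %/ d).+1%:R.
  by have := harmonic_rate f (g * d%:R) (N %/ d) fU f0; rewrite Lf subr0.
rewrite 3!normrM (ger0_norm l0) normfV normr_nat -!mulrA.
apply: le_trans (ler_piMl _ (moebius_le1 R d)) _;
    first by rewrite mulr_ge0 // mulr_ge0 ?invr_ge0.
apply: le_trans (_ : (ln N%:R - ln d%:R) * (d%:R^-1 * (K * A / (N %/ d).+1%:R)) <= _).
  by apply: ler_wpM2l => //; apply: ler_wpM2l H; rewrite invr_ge0.
set x := ln N%:R - _ in l0 *.
have -> : x * (d%:R^-1 * (K * A / (N %/ d).+1%:R)) =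
   K * A * (d%:R * (N %/ d).+1%:R)^-1 * x by rewrite invfM; ring.
have -> : K * (A * (N%:R^-1 * x)) = K * A * N%:R^-1 * x by ring.
apply: ler_wpM2r => //; apply: ler_wpM2l; [exact: mulr_ge0|exact: inv_floor_le].
Qed.

End HarmonicOperator.

(** Mertens' estimate: the integers not prime to k contribute O(1), by
    [sum_mangoldt_exceptions_bounded]. *)
Lemma prime_sum_units g : g \is a GRing.unit ->
  exists B, forall N, (0 < N)%N ->
    `|prime_sum N (fun r => (r \is a GRing.unit)%:R) g - ln N%:R| <= B.
Proof.
move=> gU; have [B HB] := sum_mangoldt_exceptions_bounded R _ (ltnW k1).
exists (B + 4) => N N0.
have M := mertens R _ N0.
set u := prime_sum _ _ _.
pose v := \sum_(1 <= n < N.+1) mangoldt n * ((~~ coprime k n)%:R / n%:R).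
have uv : \sum_(1 <= d < N.+1) mangoldt d / d%:R = u + v.
  rewrite /u /v -big_split /=; apply: eq_bigr => n _.
  rewrite unitrMr // unitZpE //; case: coprime => /=;
      first by rewrite mulr1 mul0r mulr0 addr0.
  by rewrite mulr0 add0r mul1r.
have v0 : 0 <= v by apply: sumr_ge0 => n _; rewrite mulr_ge0 ?mangoldt_ge0 // divr_ge0.
have vB : v <= B.
  apply: le_trans (HB N); apply: ler_sum => n _; apply: ler_wpM2l;
      first exact: mangoldt_ge0.
  by apply: ler_wpM2r; rewrite ?invr_ge0 // ler_nat negb_and; case: coprime; rewrite ?orbT.
by move: M; rewrite uv !ler_norml => /andP[? ?]; apply/andP; split; lra.
Qed.

End Periodic.

(** * Nonvanishing for real characters *)

Section LogGrowth.
Variable R : realType.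

Lemma ln_nat_unbounded (B : R) : exists2 N, (0 < N)%N & B < ln N%:R.
Proof.
have l2 : 0 < ln 2 :> R by apply: ln_gt0; lra.
exists (2 ^ (Num.bound `|B / ln 2|))%N; first by rewrite expn_gt0.
rewrite natrX lnXn // -[ln _ *+ _]mulr_natl -ltr_pdivrMr //.
apply: le_lt_trans (ler_norm _) _; exact: archi_boundP (normr_ge0 _).
Qed.

Lemma ln_le_harmonic N : ln N.+1%:R <= \sum_(1 <= m < N.+1) m%:R^-1 :> R.
Proof.
elim: N => [|N IH]; first by rewrite big_geq // ln1.
rewrite big_nat_recr //=; apply: le_trans (lerD IH (lexx _)).
by rewrite addrC -lerBlDr; apply: ln_natS_sub.
Qed.
End LogGrowth.

Section SqrtSums.
Variable R : realType.
Definition inv_sqrt (n : nat) : R := (Num.sqrt n%:R)^-1.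

Lemma inv_sqrt_ge0 n : 0 <= inv_sqrt n.
Proof. by rewrite invr_ge0 sqrtr_ge0. Qed.

Lemma inv_sqrtM m n : inv_sqrt (m * n) = inv_sqrt m * inv_sqrt n.
Proof. by rewrite /inv_sqrt natrM sqrtrM // invfM. Qed.

Lemma inv_sqrt_sqr n : inv_sqrt (n * n) = n%:R^-1.
Proof. by rewrite /inv_sqrt natrM -expr2 sqrtr_sqr ger0_norm. Qed.

Lemma inv_sqrt_decr n : (0 < n)%N -> inv_sqrt n.+1 <= inv_sqrt n.
Proof.
move=> n0; rewrite lef_pV2 ?posrE ?sqrtr_gt0 ?ltr0n // ler_wsqrtr // ler_nat //.
Qed.

Let sq n : R := Num.sqrt n%:R.

Lemma sqrt_natS n : sq n.+1 ^+ 2 = sq n ^+ 2 + 1.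
Proof. by rewrite /sq !sqr_sqrtr // natr1. Qed.

(** The sequence  sum of 1/sqrt n - 2 sqrt N  decreases, by steps that telescope
    against 1/sqrt n. *)
Lemma inv_sqrt_step n : (0 < n)%N ->
  0 <= 2 * (sq n.+1 - sq n) - inv_sqrt n.+1 <= inv_sqrt n - inv_sqrt n.+1.
Proof.
move=> n0; have := sqrt_natS n; rewrite /inv_sqrt -!/(sq _).
have : 0 < sq n by rewrite sqrtr_gt0 ltr0n.
have : 0 < sq n.+1 by rewrite sqrtr_gt0 ltr0n.
set a := sq n; set b := sq _ => b0 a0 E.
have ab : a <= b by rewrite -ler_sqr ?nnegrE; [rewrite E lerDl|apply: ltW|apply: ltW].
have s0 : 0 < a + b by lra.
have -> : b - a = (a + b)^-1.
  apply: (mulIf (lt0r_neq0 s0)); rewrite mulVf ?lt0r_neq0 //.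
  by rewrite -[RHS](addKr (a ^+ 2)) -E; ring.
apply/andP; split.
  have -> : 2 * (a + b)^-1 - b^-1 = (b - a) / ((a + b) * b) by field; rewrite !lt0r_neq0.
  by rewrite divr_ge0 ?subr_ge0 // mulr_ge0 ?ltW.
rewrite lerD2r -subr_ge0.
have -> : a^-1 - 2 * (a + b)^-1 = (b - a) / ((a + b) * a) by field; rewrite !lt0r_neq0.
by rewrite divr_ge0 ?subr_ge0 // mulr_ge0 ?ltW.
Qed.

Lemma sum_inv_sqrt_le N : \sum_(1 <= n < N.+1) inv_sqrt n <= 2 * sq N.
Proof.
elim: N => [|N IH]; first by rewrite big_geq // mulr_ge0 // sqrtr_ge0.
rewrite big_nat_recr //=; apply: le_trans (lerD IH (lexx _)) _.
case: N {IH} => [|N]; first by rewrite /sq /inv_sqrt sqrtr0 sqrtr1 invr1; lra.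
have /andP[] := inv_sqrt_step _ (ltn0Sn N); lra.
Qed.

(** The second argument y stands for the square root of a real number with floor M:
    the hyperbola method evaluates the sum at quotients that are not integers. *)
Lemma sum_inv_sqrt_asymp : exists C, forall M (y : R), (0 < M)%N ->
  M%:R <= y ^+ 2 < M.+1%:R -> 0 < y ->
  `|\sum_(1 <= n < M.+1) inv_sqrt n - 2 * y - C| <= 4 * y^-1.
Proof.
pose e M := \sum_(1 <= n < M.+2) inv_sqrt n - 2 * sq M.+1.
have mono N M : (N <= M)%N -> 0 <= e N - e M <= inv_sqrt N.+1 - inv_sqrt M.+1.
  elim: M => [|M IH]; first by rewrite leqn0 => /eqP ->; rewrite !subrr lexx.
  rewrite leq_eqVlt => /predU1P[<-|]; first by rewrite !subrr lexx.
  rewrite ltnS => /IH /andP[h1 h2].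
  have /andP[h3 h4] := inv_sqrt_step _ (ltn0Sn M).
  have E : e M.+1 = e M + inv_sqrt M.+2 - 2 * (sq M.+2 - sq M.+1).
    by rewrite /e big_nat_recr //=; ring.
  rewrite E; apply/andP; split; lra.
have [C HC] : exists C, forall N, `|e N - C| <= inv_sqrt N.+1.
  apply: limit_with_rate => N M /mono /andP[h1 h2].
  have := inv_sqrt_ge0 M.+1; rewrite ler_distlC => ?; apply/andP; split; lra.
have sqE n : n%:R = sq n ^+ 2 by rewrite /sq sqr_sqrtr.
exists C => M y M0; case: M M0 => // M _ /andP[].
rewrite (sqE M.+1) (sqE M.+2) (sqrt_natS M.+1) => h1 h2 y0.
have a1 : 1 <= sq M.+1.
  by rewrite -sqrtr1 ler_wsqrtr // ler1n.
have := HC M; rewrite /e /inv_sqrt -/(sq _).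
set a := sq M.+1 in h1 h2 a1 *; set S := \sum_(_ <= _ < _) _ => H.
have ay : a <= y by rewrite -ler_sqr ?nnegrE ?(le_trans ler01 a1) ?(ltW y0).
have h3 : y - a <= y^-1.
  rewrite -(ler_pM2r y0) mulVf ?lt0r_neq0 //.
  have : 0 <= a * (y - a) by rewrite mulr_ge0; lra.
  by move: h2; rewrite !expr2; lra.
have h4 : a^-1 <= 2 * y^-1.
  rewrite -[2]invrK -invfM lef_pV2 ?posrE; try lra.
  have : y <= 2 * a.
    rewrite -ler_sqr ?nnegrE; try lra.
    have : 1 <= a ^+ 2 by rewrite exprn_ege1.
    by move: h2; rewrite exprMn; lra.
  lra.
by move: H; rewrite !ler_norml => /andP[? ?]; apply/andP; split; lra.
Qed.
End SqrtSums.

Section RealCharacterNonvanishing.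
Variables (R : realType) (k : nat).
Hypothesis k1 : (1 < k)%N.

Lemma sum_squares_le (a : nat -> R) N : (forall n, 0 <= a n) ->
  \sum_(1 <= m < N.+1) a (m * m)%N <= \sum_(1 <= n < (N * N).+1) a n.
Proof.
move=> a0; elim: N => [|N IH]; first by rewrite !big_geq.
rewrite big_nat_recr //= [leRHS](@big_cat_nat _ _ _ (N * N).+1) //; last nia.
apply: lerD => //; rewrite big_nat_recr /=; last nia.
by rewrite lerDr sumr_ge0.
Qed.

(** The series chi n / n of a real character modulo k cannot have sum 0. Weigh the
    divisor sum A of chi, which is nonnegative and at least 1 at squares, by 1/sqrt n
    and sum up to N^2. The squares alone contribute ln N. The hyperbola method
    expresses the sum as 2N times the partial sum of chi d / d up to N, plus O(1);
    if the series had sum 0, this would be O(1) too. *)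
Lemma real_character_nonvanishing (chi : 'Z_k -> R) (B : R) :
  chi 1 = 1 -> (forall x y, chi (x * y) = chi x * chi y) ->
  (forall x, [\/ chi x = 0, chi x = 1 | chi x = -1]) ->
  \sum_x chi x = 0 ->
  ~ (forall N, `|\sum_(1 <= n < N.+1) chi n%:R / n%:R| <= B / N.+1%:R).
Proof.
move=> chi1 chiM chiV chi0 HB.
pose f n := chi n%:R.
have f1 : f 1%N = 1 by [].
have fM m n : f (m * n)%N = f m * f n by rewrite /f natrM chiM.
have fV n : [\/ f n = 0, f n = 1 | f n = -1] by apply: chiV.
have fle n : `|f n| <= 1 by case: (fV n) => ->; rewrite ?normr0 ?normrN ?normr1.
(* A bounds all partial sums of chi; it is the constant of Abel summation. *)
pose A := \sum_x `|chi x|.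
have A0 : 0 <= A by apply: sumr_ge0.
have B0 : 0 <= B by have := HB 0%N; rewrite divr1; apply: le_trans.
have [C HC] := sum_inv_sqrt_asymp R.
pose w := inv_sqrt R.
have wtail a b : (0 < a)%N -> `|\sum_(a <= n < b) f n * w n| <= A * w a *+ 2.
  move=> a0; apply: periodic_tail_bound => // n an; first exact: inv_sqrt_ge0.
  by apply: inv_sqrt_decr; apply: leq_trans an.
(* The bound is the sum of the estimates S1 and S2 below. *)
have [N N0 HN] := ln_nat_unbounded R (2 * B + `|C| * (A *+ 2) + 4 + A *+ 2 * 2).
have NR : 0 < N%:R :> R by rewrite ltr0n.
pose Q := \sum_(1 <= n < (N * N).+1) w n * \sum_(d <- divisors n) f d.
have lo : ln N%:R <= Q.
  apply: le_trans (ler_ln_nat R _ _ N0 (leqnSn N)) _.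
  apply: le_trans (ln_le_harmonic R N) _.
  apply: le_trans (_ : \sum_(1 <= m < N.+1) (if (0 < m * m)%N then w (m * m)%N *
      \sum_(d <- divisors (m * m)) f d else 0) <= _).
    apply: ler_sum_nat => m /andP[m0 _]; rewrite muln_gt0 m0 /w inv_sqrt_sqr.
    rewrite -[leLHS]mulr1; apply: ler_wpM2l; first by rewrite invr_ge0.
    have mm : (0 < m * m)%N by rewrite muln_gt0 m0.
    have [_] := sum_divisors_character R f f1 fM fV _ mm; apply; exact: mulnn.
  apply: le_trans (sum_squares_le (fun n => if (0 < n)%N then w n *
      \sum_(d <- divisors n) f d else 0) N _) _.
    move=> n; case: ifP => // n0; rewrite mulr_ge0 ?inv_sqrt_ge0 //.
    by have [] := sum_divisors_character R f f1 fM fV _ n0.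
  by apply: ler_sum_nat => n /andP[-> _].
pose H M := \sum_(1 <= m < M.+1) w m.
(* The pairs (d, m) with d m <= N^2 are split at d = N; for d > N one has m <= N,
   and the summation over d is performed first. *)
have E : Q = \sum_(1 <= d < N.+1) f d * w d * H (N * N %/ d)%N +
   \sum_(1 <= m < N.+1) w m * \sum_(N.+1 <= d < (N * N %/ m).+1) f d * w d.
  have -> : Q = \sum_(1 <= d < (N * N).+1) f d * w d * H (N * N %/ d)%N.
    pose F d m := f d * w d * w m.
    transitivity (\sum_(1 <= n < (N * N).+1) \sum_(d <- divisors n) F d (n %/ d)%N).
      apply: eq_big_nat => n /andP[n0 _]; rewrite mulr_sumr big_seq [RHS]big_seq.
      apply: eq_bigr => d; rewrite -dvdn_divisors // => dn.
      by rewrite /F -mulrA /w -inv_sqrtM [(d * _)%N]mulnC divnK // mulrC.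
    by rewrite sum_divisors_swap; apply: eq_bigr => d _; rewrite mulr_sumr.
  rewrite (@big_cat_nat _ _ _ N.+1 1 (N * N).+1) //=; last by rewrite ltnS leq_pmull.
  congr (_ + _).
  transitivity (\sum_(N.+1 <= d < (N * N).+1) \sum_(1 <= m < N.+1)
      if (d * m <= N * N)%N then f d * w d * w m else 0).
    apply: eq_big_nat => d /andP[Nd _]; have d0 : (0 < d)%N by apply: leq_trans Nd.
    rewrite mulr_sumr (@big_nat_widen _ _ _ _ _ N.+1); last first.
      by rewrite ltnS -[leqRHS](mulnK N N0) leq_div2l // ltnW.
    rewrite big_mkcond; apply: eq_bigr => m _ /=.
    by rewrite ltnS leq_divRL // mulnC.
  rewrite exchange_big /=; apply: eq_big_nat => m /andP[m0 mN].
  rewrite mulr_sumr [RHS](@big_nat_widen _ _ _ _ _ (N * N).+1) ?ltnS ?leq_div //.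
  rewrite [RHS]big_mkcond; apply: eq_bigr => d _ /=.
  by rewrite ltnS leq_divRL // [_ * w m]mulrC.
have S2 : `|\sum_(1 <= m < N.+1) w m * \sum_(N.+1 <= d < (N * N %/ m).+1) f d * w d| <= A
    *+ 2 * 2.
  apply: le_trans (ler_norm_sum _ _ _) _.
  apply: le_trans (_ : (A * w N.+1 *+ 2) * H N <= _).
    rewrite mulr_sumr; apply: ler_sum_nat => m _.
    rewrite normrM ger0_norm ?inv_sqrt_ge0 // mulrC; apply: ler_wpM2r;
        first exact: inv_sqrt_ge0.
    exact: wtail.
  apply: le_trans (ler_wpM2l _ (sum_inv_sqrt_le R N)) _.
    by rewrite mulrn_wge0 // mulr_ge0 // inv_sqrt_ge0.
  rewrite -mulrnAl -mulrA; apply: ler_wpM2l; first exact: mulrn_wge0.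
  rewrite mulrCA -[leRHS]mulr1; apply: ler_wpM2l => //.
  rewrite mulrC /w /inv_sqrt ler_pdivrMr ?sqrtr_gt0 // mul1r.
  by rewrite ler_wsqrtr // ler_nat.
have S1 : `|\sum_(1 <= d < N.+1) f d * w d * H (N * N %/ d)%N| <=
    2 * B + `|C| * (A *+ 2) + 4.
  have -> : \sum_(1 <= d < N.+1) f d * w d * H (N * N %/ d)%N =
     2 * N%:R * (\sum_(1 <= d < N.+1) f d / d%:R) +
     C * (\sum_(1 <= d < N.+1) f d * w d) +
     \sum_(1 <= d < N.+1) f d * w d * (H (N * N %/ d)%N - 2 * (N%:R * w d) - C).
    rewrite !mulr_sumr -!big_split /=; apply: eq_big_nat => d _.
    by rewrite -(inv_sqrt_sqr R d) inv_sqrtM -/w; ring.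
  apply: le_trans (ler_normD _ _) _; apply: lerD.
    apply: le_trans (ler_normD _ _) _; apply: lerD.
      rewrite normrM (ger0_norm (_ : 0 <= 2 * N%:R)) ?mulr_ge0 // -mulrA;
          apply: ler_wpM2l => //.
      apply: le_trans (ler_wpM2l _ (HB N)) _ => //.
      rewrite mulrCA -[leRHS]mulr1; apply: ler_wpM2l => //.
      by rewrite ler_pdivrMr // mul1r ler_nat.
    rewrite normrM; apply: ler_wpM2l => //.
    by have := wtail 1%N N.+1 isT; rewrite /w /inv_sqrt sqrtr1 invr1 mulr1.
  apply: le_trans (ler_norm_sum _ _ _) _.
  apply: le_trans (_ : \sum_(1 <= d < N.+1) 4 / N%:R <= _); last first.
    by rewrite sumr_const_nat subn1 -[_ *+ _]mulr_natr divfK ?gt_eqF.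
  apply: ler_sum_nat => d /andP[d0 dN].
  have wd : 0 < w d by rewrite /w /inv_sqrt invr_gt0 sqrtr_gt0 ltr0n.
  have Nd : (N <= N * N %/ d)%N by rewrite leq_divRL // leq_mul2l -ltnS dN orbT.
  have y2 : (N%:R * w d) ^+ 2 = (N * N)%N%:R / d%:R.
    by rewrite exprMn expr2 -natrM [w d ^+ 2]expr2 /w -inv_sqrtM inv_sqrt_sqr.
  have NNd : (N * N %/ d)%N%:R <= (N%:R * w d) ^+ 2 < (N * N %/ d).+1%:R.
    rewrite y2 ler_pdivlMr ?ltr0n // ltr_pdivrMr ?ltr0n // -!natrM ler_nat ltr_nat.
    by rewrite leq_divM ltn_ceil.
  have y0 : 0 < N%:R * w d by rewrite mulr_gt0.
  have HH := HC (N * N %/ d)%N (N%:R * w d) (leq_trans N0 Nd) NNd y0.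
  rewrite normrM; apply: le_trans (_ : w d * (4 * (N%:R * w d)^-1) <= _).
    apply: ler_pM => //; rewrite normrM (ger0_norm (ltW wd)).
    by apply: ler_piMl; [exact: ltW|exact: fle].
  by rewrite invfM mulrCA [w d * _]mulrCA divff ?gt_eqF // mulr1.
move: lo HN; have := ler_norm Q; rewrite E.
move/le_trans/(_ (ler_normD _ _)); move: S1 S2 => s1 s2.
have := lerD s1 s2; lra.
Qed.
End RealCharacterNonvanishing.

(** * The limit operator on functions modulo k *)

(** A linear map that is injective on its image has the same image as its square,
    for dimension reasons. *)
Lemma lfun_image_stable (F : fieldType) (vT : vectType F) (U : {vspace vT})
    (h : 'End(vT)) :
  (h @: U <= U)%VS ->
  (forall w, w \in U -> h (h w) = 0 -> h w = 0) ->
  forall v, v \in U -> exists2 w, w \in U & h (h w) = h v.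
Proof.
move=> hU hinj v vU; pose W := (h @: U)%VS.
have WW : (h @: W = W)%VS.
  apply/eqP; rewrite eqEdim limgS // limg_dim_eq ?leqnn //.
  apply/eqP; rewrite -subv0; apply/subvP => x.
  rewrite memv_cap memv_ker memv0 => /andP[/memv_imgP[w wU ->] /eqP hw].
  by apply/eqP/hinj.
have : h v \in (h @: W)%VS by rewrite WW memv_img.
by move=> /memv_imgP[_ /memv_imgP[w wU ->] hv]; exists w.
Qed.

Section LogCoefficient.
Variable R : realType.

Definition log_coef (u : nat -> R) (x : R) :=
  exists B, forall N, (0 < N)%N -> `|u N - x * ln N%:R| <= B.

Lemma log_coefD u v x y : log_coef u x -> log_coef v y ->
  log_coef (fun N => u N + v N) (x + y).
Proof.
move=> [B HB] [B' HB']; exists (B + B') => N N0.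
have -> : u N + v N - (x + y) * ln N%:R = (u N - x * ln N%:R) + (v N - y * ln N%:R) by ring.
by apply: le_trans (ler_normD _ _) (lerD _ _); [apply: HB|apply: HB'].
Qed.

Lemma log_coefZ u x a : log_coef u x -> log_coef (fun N => a * u N) (a * x).
Proof.
move=> [B HB]; exists (`|a| * B) => N N0.
by rewrite -mulrA -mulrBr normrM; apply: ler_wpM2l => //; apply: HB.
Qed.

Lemma log_coef0 : log_coef (fun=> 0) 0.
Proof. by exists 0 => N _; rewrite mul0r subrr normr0. Qed.

Lemma log_coef_sum (I : finType) (P : pred I) (u : I -> nat -> R) (x : I -> R) :
  (forall i, P i -> log_coef (u i) (x i)) ->
  log_coef (fun N => \sum_(i | P i) u i N) (\sum_(i | P i) x i).
Proof.
move=> H; elim: (index_enum I) => [|i s IH].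
  suff -> : (fun N => \sum_(i <- [::] | P i) u i N) = fun=> 0.
    by rewrite big_nil; exact: log_coef0.
  by apply/funext => N; rewrite big_nil.
rewrite big_cons.
under eq_fun do rewrite big_cons.
by case: ifPn => // Pi; apply: log_coefD => //; apply: H.
Qed.

Lemma log_coef_ge0 u x : log_coef u x -> (forall N, 0 <= u N) -> 0 <= x.
Proof.
move=> [B HB] u0; rewrite leNgt; apply/negP => x0.
have [N N0 HN] := ln_nat_unbounded R (B / - x).
have := HB N N0; have := u0 N; move: HN; rewrite ltr_pdivrMr ?oppr_gt0 //.
rewrite ler_norml => ? ? /andP[? ?]; lra.
Qed.

Lemma log_coef_uniq u x y : log_coef u x -> log_coef u y -> x = y.
Proof.
move=> ux uy.
have D a b : log_coef u a -> log_coef u b -> 0 <= a - b.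
  move=> ua ub; have := log_coefD _ _ _ _ ua (log_coefZ _ _ (-1) ub); rewrite mulN1r.
  by move/log_coef_ge0; apply => N; rewrite mulN1r subrr.
by apply/eqP; rewrite eq_le -!(subr_ge0 x) -!(subr_ge0 y) !D.
Qed.

End LogCoefficient.

Section GroupAlgebra.
Variables (R : realType) (k : nat).
Hypothesis k1 : (1 < k)%N.
Variables (C : 'Z_k -> R) (K : R).
Hypothesis K0 : 0 <= K.
Hypothesis CK : forall phi : 'Z_k -> R, \sum_r phi r = 0 -> forall N,
  `|\sum_(1 <= n < N.+1) phi n%:R / n%:R - \sum_r C r * phi r| <=
     K * (\sum_r `|phi r|) / N.+1%:R.

Let V := {ffun 'Z_k -> R^o}.
Implicit Types (f v w : V) (g r s : 'Z_k).

Definition harmonic_lin f : V := [ffun g => harmonic_op R k C f g].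

Lemma harmonic_lin_linear : linear harmonic_lin.
Proof.
move=> a f f'; apply/ffunP => g; rewrite !ffunE /harmonic_op scaler_sumr -big_split.
apply: eq_bigr => r _; rewrite !ffunE /= mulrDr; congr (_ + _).
by rewrite /GRing.scale /= mulrCA.
Qed.
HB.instance Definition _ := GRing.isLinear.Build R V V *:%R harmonic_lin
    harmonic_lin_linear.

(** The subspace of mean-zero functions on the unit group is the kernel of this map, which
    collects its two defining conditions in one linear map: the sum at the
    units, the values at the other classes. *)
Definition mean_zero_constraint f : V :=
  [ffun r => if r \is a GRing.unit then \sum_s f s else f r].

Lemma mean_zero_constraint_linear : linear mean_zero_constraint.
Proof.
move=> a f f'; apply/ffunP => g; rewrite !ffunE; case: ifP => _.
  by rewrite scaler_sumr -big_split; apply: eq_bigr => s _; rewrite !ffunE.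
by [].
Qed.
HB.instance Definition _ :=
  GRing.isLinear.Build R V V *:%R mean_zero_constraint mean_zero_constraint_linear.

Definition mean_zero_space : {vspace V} := lker (linfun mean_zero_constraint).

Lemma mean_zero_spaceP f : reflect (unit_supported R k f /\ \sum_r f r = 0) (f \in
    mean_zero_space).
Proof.
rewrite memv_ker lfunE /=; apply: (iffP eqP) => [/ffunP H|[fU f0]].
  split; last by have := H 1; rewrite !ffunE unitr1.
  by move=> r /negPf rU; have := H r; rewrite !ffunE rU.
apply/ffunP => r; rewrite !ffunE; case: ifPn => // rU; exact: fU.
Qed.

Lemma harmonic_lin_mean_zero f : f \in mean_zero_space -> harmonic_lin f \in
    mean_zero_space.
Proof.
move=> /mean_zero_spaceP[fU f0]; apply/mean_zero_spaceP; split.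
  move=> r rU; rewrite ffunE /harmonic_op big1 // => s _.
  by rewrite translate_nonunit ?mulr0.
under eq_bigr do rewrite ffunE /harmonic_op.
rewrite exchange_big big1 //= => r _; rewrite -mulr_sumr.
under eq_bigr do rewrite mulrC.
by rewrite sum_translate0 // mulr0.
Qed.

Local Notation T f g := (fun N => prime_sum R k N f g).

Lemma prime_sum_linear a f f' g N :
  prime_sum R k N (a *: f + f') g = a * prime_sum R k N f g + prime_sum R k N f' g.
Proof.
rewrite /prime_sum mulr_sumr -big_split; apply: eq_bigr => n _.
rewrite !ffunE /GRing.scale /=; ring.
Qed.

Lemma log_coef_image w g : w \in mean_zero_space -> log_coef R (T (harmonic_lin w) g) 0.
Proof.
move=> /mean_zero_spaceP[wU w0]; have [B HB] := prime_sum_image R k k1 C K K0 CK w g wU w0.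
exists B => N N0; rewrite mul0r subr0.
suff -> : prime_sum R k N (harmonic_lin w) g = prime_sum R k N (harmonic_op R k C w) g by
    apply: HB.
by apply: eq_bigr => n _; rewrite ffunE.
Qed.

Lemma log_coef_kernel v g : v \in mean_zero_space -> harmonic_lin v = 0 -> log_coef R (T
    v g) (- v g).
Proof.
move=> /mean_zero_spaceP[vU v0] hv.
have Lv r : harmonic_op R k C v r = 0.
  by have /ffunP/(_ r) := hv; rewrite !ffunE.
have [B HB] := prime_sum_kernel R k C K K0 CK v g vU v0 Lv.
by exists B => N N0; rewrite mulNr opprK; apply: HB.
Qed.

(** On the kernel of L the prime sums of a function f are - f ln N + O(1), on the
    image of L they are O(1); a function in both vanishes. *)
Lemma harmonic_lin_inj_image w : w \in mean_zero_space -> harmonic_lin (harmonic_lin w) =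
    0 -> harmonic_lin w = 0.
Proof.
move=> wF hhw; apply/ffunP => g; rewrite [RHS]ffunE.
have := log_coef_kernel (harmonic_lin w) g (harmonic_lin_mean_zero _ wF) hhw.
by move/(log_coef_uniq R _ _ _ (log_coef_image w g wF))/esym/eqP; rewrite oppr_eq0 => /eqP.
Qed.

(** The kernel and the image of L meet in 0 by the previous lemma, so together they span
    the mean-zero functions. *)
Lemma mean_zero_decomp f : f \in mean_zero_space ->
  exists w v, [/\ w \in mean_zero_space, v \in mean_zero_space, harmonic_lin v = 0 & f =
      harmonic_lin w + v].
Proof.
move=> fF.
have [] := @lfun_image_stable R V mean_zero_space (linfun harmonic_lin) _ _ f fF.
- apply/subvP => _ /memv_imgP[w wF ->]; rewrite lfunE; exact: harmonic_lin_mean_zero.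
- by move=> w wF; rewrite !lfunE /=; apply: harmonic_lin_inj_image.
move=> w wF; rewrite !lfunE /= => E.
exists w, (f - harmonic_lin w); split => //; last by rewrite addrC subrK.
- by apply: rpredB => //; apply: harmonic_lin_mean_zero.
- by rewrite linearB /= E subrr.
Qed.

Definition unit_ind : V := [ffun r => (r \is a GRing.unit)%:R].
Definition dirac_at s : V := [ffun r => (r == s)%:R].
Let q : R := (\sum_r unit_ind r)^-1.

Lemma sum_unit_ind_gt0 : 0 < \sum_r unit_ind r.
Proof.
rewrite (bigD1 1) //= ffunE unitr1 ltr_pwDl // sumr_ge0 // => r _; rewrite ffunE;
    exact: ler0n.
Qed.

Lemma unit_ind_supported : unit_supported R k unit_ind.
Proof. by move=> r /negPf rU; rewrite ffunE rU. Qed.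

Lemma dirac_supported s : s \is a GRing.unit -> unit_supported R k (dirac_at s).
Proof. by move=> sU r rU; rewrite ffunE; case: eqP => // rs; rewrite rs sU in rU. Qed.

Lemma centered_mean_zero f : unit_supported R k f -> f - (q * \sum_r f r) *: unit_ind \in
    mean_zero_space.
Proof.
move=> fU; apply/mean_zero_spaceP; split.
  move=> r rU; rewrite !ffunE fU // (negPf rU) sub0r /GRing.scale /= mulr0 oppr0 //.
under eq_bigr do rewrite ffunE [X in _ + X]ffunE [X in - X]ffunE.
rewrite sumrB -scaler_sumr /GRing.scale /= mulrAC /q mulVf ?mul1r ?subrr //.
by rewrite gt_eqF // sum_unit_ind_gt0.
Qed.

Lemma log_coef_unit_ind g : g \is a GRing.unit -> log_coef R (T unit_ind g) 1.
Proof.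
move=> gU; have [B HB] := prime_sum_units R k k1 g gU; exists B => N N0; rewrite mul1r.
suff -> : prime_sum R k N unit_ind g =
  prime_sum R k N (fun r => (r \is a GRing.unit)%:R) g by apply: HB.
by apply: eq_bigr => n _; rewrite ffunE.
Qed.

(** A function on the units is a constant, plus an element of the image of L, plus an
    element of its kernel; the asymptotics of the prime sums is known on each. *)
Lemma log_coef_exists f g : unit_supported R k f -> g \is a GRing.unit ->
  exists x, log_coef R (T f g) x.
Proof.
move=> fU gU; have fF := centered_mean_zero _ fU.
have [w [v [wF vF hv fE]]] := mean_zero_decomp _ fF.
set m := q * _ in fE.
have -> : f = m *: unit_ind + (1 *: harmonic_lin w + v).
  by rewrite scale1r -fE addrC subrK.
exists (m * 1 + (1 * 0 + - v g)).
rewrite (_ : (fun N => _) = (fun N =>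
    m * T unit_ind g N + (1 * T (harmonic_lin w) g N + T v g N))); last first.
  by apply/funext => N; rewrite !prime_sum_linear.
apply: log_coefD; first by apply: log_coefZ; apply: log_coef_unit_ind.
apply: log_coefD; last exact: log_coef_kernel.
by apply: log_coefZ; apply: log_coef_image.
Qed.

Section LimitOperator.
Variable c : 'Z_k -> R.
Hypothesis Hc : forall s, s \is a GRing.unit -> log_coef R (T (dirac_at s) 1) (c s).

(** The limit E of the operators T_N / ln N. It is a convolution by nonnegative weights
    c, the logarithmic densities of the primes in the classes modulo k. *)
Definition limit_op (f : V) g : R := \sum_(s | s \is a GRing.unit) f (g * s) * c s.

Lemma limit_coef_ge0 s : s \is a GRing.unit -> 0 <= c s.
Proof.
move=> /Hc /log_coef_ge0; apply => N; apply: sumr_ge0 => n _.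
by rewrite mulr_ge0 ?divr_ge0 ?mangoldt_ge0 // ffunE ler0n.
Qed.

Lemma log_coef_limit f g : unit_supported R k f -> log_coef R (T f g) (limit_op f g).
Proof.
move=> fU.
rewrite (_ : (fun N => _) = (fun N =>
    \sum_(s | s \is a GRing.unit) f (g * s) * T (dirac_at s) 1 N)).
  by apply: log_coef_sum => s sU; apply: log_coefZ; apply: Hc.
apply/funext => N; under [RHS]eq_bigr do rewrite mulr_sumr.
rewrite exchange_big /=; apply: eq_bigr => n _.
under eq_bigr do rewrite mulrCA ffunE mul1r.
rewrite -mulr_sumr; congr (_ * _).
have [nU|nU] := boolP (n%:R \is a @GRing.unit 'Z_k).
  rewrite (bigD1 n%:R) //= eqxx mulr1 big1 ?addr0 // => s /andP[_].
  by rewrite eq_sym => /negPf ->; rewrite mulr0.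
rewrite big1 => [|s sU]; first by rewrite fU // unitrM negb_and nU orbT.
by case: eqP => [E|_]; rewrite ?mulr0 // -E (negPf nU) in sU *.
Qed.

Lemma limit_op_linear a f f' g :
  limit_op (a *: f + f') g = a * limit_op f g + limit_op f' g.
Proof.
rewrite /limit_op mulr_sumr -big_split; apply: eq_bigr => s _.
by rewrite !ffunE /GRing.scale /=; ring.
Qed.

Lemma limit_op_image w g : w \in mean_zero_space -> limit_op (harmonic_lin w) g = 0.
Proof.
move=> wF; have /mean_zero_spaceP[hU _] := harmonic_lin_mean_zero _ wF.
exact: log_coef_uniq (log_coef_limit _ g hU) (log_coef_image _ g wF).
Qed.

Lemma limit_op_kernel v g : v \in mean_zero_space -> harmonic_lin v = 0 -> limit_op v g =
    - v g.
Proof.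
move=> vF hv; have /mean_zero_spaceP[vU _] := vF.
exact: log_coef_uniq (log_coef_limit _ g vU) (log_coef_kernel _ g vF hv).
Qed.

Lemma limit_op_unit_ind g : g \is a GRing.unit -> limit_op unit_ind g = 1.
Proof.
by move=> gU; apply: log_coef_uniq (log_coef_limit _ g unit_ind_supported)
    (log_coef_unit_ind _ gU).
Qed.

Lemma sum_limit_coef : \sum_(s | s \is a GRing.unit) c s = 1.
Proof.
rewrite -(limit_op_unit_ind 1 (unitr1 _)); apply: eq_bigr => s sU.
by rewrite ffunE mul1r sU mul1r.
Qed.

(** E is the identity on constants, 0 on the image of L and - 1 on its kernel, so that
    its fixed points are the constants. *)
Lemma limit_op_fixed f : unit_supported R k f ->
  (forall g, g \is a GRing.unit -> limit_op f g = f g) ->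
  forall g, g \is a GRing.unit -> f g = q * \sum_r f r.
Proof.
move=> fU fE g gU.
set m := q * _; pose f0 := f - m *: unit_ind.
have f0F : f0 \in mean_zero_space by apply: centered_mean_zero.
have [w [v [wF vF hv f0E]]] := mean_zero_decomp _ f0F.
have /mean_zero_spaceP[vU _] := vF; have /mean_zero_spaceP[f0U _] := f0F.
have f0g r : r \is a GRing.unit -> f0 r = f r - m.
  by move=> rU; rewrite !ffunE rU /GRing.scale /= mulr1.
have H1 r : r \is a GRing.unit -> f0 r = - v r.
  move=> rU; rewrite f0g //.
  have <- : limit_op f0 r = f r - m.
    rewrite /f0 addrC -scaleNr limit_op_linear fE // limit_op_unit_ind //; ring.
  by rewrite f0E -(scale1r (harmonic_lin w)) limit_op_linear limit_op_image //
      limit_op_kernel //; ring.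
have f0v : f0 = - v.
  apply/ffunP => r; rewrite [RHS]ffunE.
  by have [/H1//|rU] := boolP (r \is a GRing.unit); rewrite f0U // vU // oppr0.
have H2 : limit_op f0 g = v g.
  have -> : f0 = -1 *: v + 0 by rewrite addr0 scaleN1r.
  rewrite limit_op_linear limit_op_kernel // mulN1r opprK.
  by rewrite /limit_op big1 ?addr0 // => s _; rewrite ffunE mul0r.
have H3 : limit_op f0 g = - v g.
  by rewrite f0E -(scale1r (harmonic_lin w)) limit_op_linear limit_op_image //
      limit_op_kernel //; ring.
have vg0 : v g = 0 by move: H3; rewrite H2; lra.
by have := f0g g gU; rewrite H1 // vg0 oppr0 => /eqP; rewrite eq_sym subr_eq0 => /eqP.
Qed.

(** |v| = |E v| <= E |v| pointwise, with the same sum over the units because the weights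
    of E have sum 1. Hence |v| is fixed by E and is constant. Positivity of
    the weights, that is of the von Mangoldt function, enters here. *)
Lemma kernel_abs_const v : v \in mean_zero_space -> harmonic_lin v = 0 ->
  forall g, g \is a GRing.unit -> `|v g| = `|v 1|.
Proof.
move=> vF hv; have /mean_zero_spaceP[vU _] := vF.
pose a : V := [ffun r => `|v r|].
have aU : unit_supported R k a by move=> r rU; rewrite ffunE vU ?normr0.
have le g : a g <= limit_op a g.
  rewrite ffunE -normrN -limit_op_kernel //.
  apply: le_trans (ler_norm_sum _ _ _) _; apply: ler_sum => s sU.
  by rewrite normrM (ger0_norm (limit_coef_ge0 _ sU)) ffunE.
have sumE : \sum_g limit_op a g = \sum_g a g.
  rewrite exchange_big /=.
  under eq_bigr => s sU.
    rewrite -mulr_suml (eq_bigr (fun i => a (s * i))); last by move=> i _; rewrite mulrC.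
    rewrite sum_translate //; over.
  by rewrite -mulr_sumr sum_limit_coef mulr1.
have eqa g : limit_op a g = a g.
  apply/eqP; rewrite -subr_eq0; apply/eqP.
  apply: (@psumr_eq0P _ _ xpredT (fun g => limit_op a g - a g)) => // [r _|].
    by rewrite subr_ge0.
  by rewrite sumrB sumE subrr.
have H := limit_op_fixed _ aU (fun g _ => eqa g).
by move=> g gU; have := H g gU; rewrite -(H 1 (unitr1 _)) !ffunE.
Qed.

Definition shift_fun v g : V := [ffun r => v (g * r)].

Lemma shift_mean_zero v g : v \in mean_zero_space -> shift_fun v g \in mean_zero_space.
Proof.
move=> /mean_zero_spaceP[vU v0]; apply/mean_zero_spaceP; split.
  by move=> r rU; rewrite ffunE vU // unitrM negb_and rU orbT.
by under eq_bigr do rewrite ffunE; apply: sum_translate0.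
Qed.

Lemma harmonic_lin_shift v g : harmonic_lin v = 0 -> harmonic_lin (shift_fun v g) = 0.
Proof.
move=> /ffunP hv; apply/ffunP => r; have := hv (g * r); rewrite !ffunE => <-.
by apply: eq_bigr => s _; rewrite ffunE mulrA.
Qed.

(** Normalize v by v 1 = 1; then v takes the values 1 and -1 on the units. The kernel is
    stable under translations, so v + v (x * _) also has constant absolute value
    on the units: if v x = 1 it is 2 and v (x * _) = v, if v x = -1 it is 0 and
    v (x * _) = - v. In both cases v (x * _) = v x * v. *)
Lemma kernel_real_character v : v \in mean_zero_space -> harmonic_lin v = 0 -> v != 0 ->
  exists chi : V, [/\ chi \in mean_zero_space, harmonic_lin chi = 0, chi 1 = 1,
    forall x y, chi (x * y) = chi x * chi y &
    forall x, [\/ chi x = 0, chi x = 1 | chi x = -1]].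
Proof.
move=> vF hv v0; have /mean_zero_spaceP[vU _] := vF.
have v1 : v 1 != 0.
  apply: contra v0 => /eqP v10; apply/eqP/ffunP => r; rewrite [RHS]ffunE.
  have [rU|/vU//] := boolP (r \is a GRing.unit).
  by apply/eqP; rewrite -normr_eq0 kernel_abs_const // v10 normr0.
pose chi : V := (v 1)^-1 *: v.
have chiF : chi \in mean_zero_space by apply: rpredZ.
have hchi : harmonic_lin chi = 0 by rewrite linearZ /= hv scaler0.
have chi1 : chi 1 = 1 by rewrite ffunE /GRing.scale /= mulVf.
have /mean_zero_spaceP[chiU _] := chiF.
have chi_sgn x : x \is a GRing.unit -> chi x = 1 \/ chi x = -1.
  move=> xU; have := kernel_abs_const _ chiF hchi x xU; rewrite chi1 normr1.
  by move/eqP; rewrite eqr_norml ler01 andbT => /orP[/eqP|/eqP]; [left|right].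
exists chi; split=> //; last first.
  by move=> x; have [/chi_sgn[]|/chiU] := boolP (x \is a GRing.unit);
    [constructor 2|constructor 3|constructor 1].
move=> x y.
have [xyU|xyN] := boolP (x * y \is a GRing.unit); last first.
  rewrite (chiU _ xyN); move: xyN; rewrite unitrM negb_and.
  by case/orP => /chiU ->; rewrite ?mul0r ?mulr0.
have /andP[xU yU] : (x \is a GRing.unit) && (y \is a GRing.unit) by rewrite -unitrM.
pose u : V := chi + shift_fun chi x.
have uF : u \in mean_zero_space by apply: rpredD => //; apply: shift_mean_zero.
have hu : harmonic_lin u = 0 by rewrite linearD /= hchi harmonic_lin_shift // addr0.
have := kernel_abs_const _ uF hu y yU.
have uE r : u r = chi r + chi (x * r) by rewrite [LHS]ffunE [X in _ + X]ffunE.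
rewrite !uE mulr1 chi1.
case: (chi_sgn _ xyU) => ->; case: (chi_sgn _ xU) => ->; case: (chi_sgn _ yU) => ->;
  rewrite ?(mulr1, mul1r, mulrN1, opprK) // ?subrr ?addNr ?normr0 -?opprD ?normrN => /eqP;
  rewrite ?normr_eq0 1?eq_sym ?normr_eq0; lra.
Qed.

Lemma kernel_trivial v : v \in mean_zero_space -> harmonic_lin v = 0 -> v = 0.
Proof.
move=> vF hv; apply/eqP; apply/negPn/negP => v0.
have [chi [chiF hchi chi1 chiM chiV]] := kernel_real_character v vF hv v0.
have /mean_zero_spaceP[chiU chi0] := chiF.
apply: (real_character_nonvanishing R k k1 chi (K * \sum_r `|chi r|)) => // N.
have := harmonic_rate R k C K K0 CK chi 1 N chiU chi0.
have -> : harmonic_op R k C chi 1 = 0 by have /ffunP/(_ 1) := hchi; rewrite !ffunE.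
by rewrite subr0; under eq_bigr do rewrite mul1r.
Qed.

(** As L is injective on mean-zero functions, the limit operator vanishes on these,
    and the primes are equidistributed among the invertible classes. *)
Lemma limit_uniform s : s \is a GRing.unit -> c s = q.
Proof.
move=> sU; have dU := dirac_supported _ sU.
have [w [v [wF vF hv E]]] := mean_zero_decomp _ (centered_mean_zero _ dU).
have sum1 : \sum_r dirac_at s r = 1.
  by rewrite (bigD1 s) //= ffunE eqxx big1 ?addr0 // => r /negPf rs; rewrite ffunE rs.
have <- : limit_op (dirac_at s) 1 = c s.
  rewrite /limit_op (bigD1 s) //= ffunE mul1r eqxx mul1r big1 ?addr0 // =>
      r /andP[_ /negPf rs].
  by rewrite ffunE mul1r rs mul0r.
rewrite sum1 mulr1 (kernel_trivial v vF hv) addr0 in E.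
have -> : dirac_at s = q *: unit_ind + harmonic_lin w by rewrite -E addrC subrK.
by rewrite limit_op_linear limit_op_unit_ind ?unitr1 // limit_op_image // mulr1 addr0.
Qed.
End LimitOperator.

Lemma prime_sum_dirac s : s \is a GRing.unit ->
  log_coef R (T (dirac_at s) 1) q.
Proof.
move=> sU.
have /fin_all_exists[c Hc] : forall r, exists x, r \is a GRing.unit ->
    log_coef R (T (dirac_at r) 1) x.
  move=> r; have [rU|rN] := boolP (r \is a GRing.unit); last by exists 0.
  have [x Hx] := log_coef_exists _ 1 (dirac_supported _ rU) (unitr1 _).
  by exists x.
by rewrite -(limit_uniform c Hc s sU); apply: Hc.
Qed.

End GroupAlgebra.

(** * Primes in arithmetic progressions *)

Section PrimesInProgressions.
Variable R : realType.

(** Dirichlet's theorem, in the quantitative form of Mertens. The factor a is the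
    inverse of the number of invertible classes modulo k. *)
Lemma sum_ln_prime_ge k h : (1 < k)%N -> coprime k h ->
  exists a B : R, 0 < a /\ forall N, (0 < N)%N ->
  a * ln N%:R - B <= \sum_(1 <= p < N.+1 | prime p && (p == h %[mod k])) ln p%:R / p%:R.
Proof.
move=> k1 kh; have [C [K [K0 CK]]] := harmonic_constants R k k1.
have hU : (h%:R : 'Z_k) \is a GRing.unit by rewrite unitZpE.
have [B HB] := prime_sum_dirac R k k1 C K K0 CK _ hU.
have [B' HB'] := sum_mangoldt_exceptions_bounded R k (ltnW k1).
set a : R := _^-1 in HB; exists a, (B + B'); split.
  by rewrite invr_gt0 sum_unit_ind_gt0.
move=> N N0; have := HB N N0; have := HB' N.
set X := \sum_(_ <= _ < _) _; set Y := prime_sum _ _ _ _ _;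
    set Z := \sum_(_ <= _ < _ | _) _.
suff : Y <= X + Z by rewrite ler_norml => ? ? /andP[? ?]; lra.
rewrite /Y /X /Z [X in _ <= _ + X]big_mkcond -big_split;
    apply: ler_sum_nat => p /andP[p0 pN] /=.
have m0 := mangoldt_ge0 R p.
have g0 : 0 <= mangoldt R p / p%:R by rewrite divr_ge0.
rewrite ffunE mul1r mulrCA.
have E : (p%:R == h%:R :> 'Z_k) = (p == h %[mod k]).
  by rewrite -val_eqE /= !val_Zp_nat.
rewrite E; case: (boolP (prime p)) => pp /=; last first.
  by rewrite addr0 mul1r; apply: ler_piMr => //; case: eqP.
have l0 : 0 <= ln p%:R / p%:R :> R by rewrite divr_ge0 ?ln_nat_ge0.
case: eqP => _; rewrite ?mulr1 ?mulr0; last by rewrite addr0 mulr_ge0.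
apply: ler_wpDl; first by rewrite mulr_ge0 ?divr_ge0.
apply: ler_wpM2r; first by rewrite invr_ge0.
exact: mangoldt_le_ln.
Qed.

End PrimesInProgressions.

Section PrimeReciprocals.
Variables (R : realType) (k h : nat).
Hypotheses (k0 : (0 < k)%N) (kh : coprime k h).

Let inclass p := prime p && (p == h %[mod k]).

(** The rings 'Z_k are defined for k > 1 only. All primes lie in the same class modulo 1,
    so that the case k = 1 follows from the class of 1 modulo 2. *)
Lemma sum_ln_class_ge : exists a B : R, 0 < a /\ forall N, (0 < N)%N ->
  a * ln N%:R - B <= \sum_(1 <= p < N.+1 | inclass p) ln p%:R / p%:R.
Proof.
case: (ltngtP k 1) => [|k1|k1]; first by rewrite ltnNge k0.
  exact: sum_ln_prime_ge.
have [a [B [a0 H]]] := sum_ln_prime_ge R 2 1 isT isT.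
exists a, B; split=> // N N0; apply: le_trans (H N N0) _.
rewrite big_mkcond [leRHS]big_mkcond; apply: ler_sum => p _.
rewrite /inclass k1 !modn1 eqxx andbT; case: prime => //=.
by case: eqP => // _; rewrite divr_ge0 ?ln_nat_ge0.
Qed.

(** If the sum of 1/p over the class converged, its tail beyond some P would be at most
    a/2, and the sum of ln p / p up to N at most (a/2) ln N + O(1), against
    [sum_ln_class_ge]. *)
Lemma sum_inv_class_unbounded (B : R) :
  exists N, B < \sum_(1 <= p < N.+1 | inclass p) p%:R^-1.
Proof.
apply/not_existsP => Hle.
pose s N : R := \sum_(1 <= p < N.+1 | inclass p) p%:R^-1.
have sB N : s N <= B by rewrite leNgt; apply/negP; apply: Hle.
have [a [B' [a0 H]]] := sum_ln_class_ge.
pose S := [set s N | N in [set: nat]].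
have hS : has_sup S by split; [exists (s 0%N), 0%N | exists B => _ [N _ <-]].
have a2 : 0 < a / 2 by lra.
have [_ [P _ <-] HP] := sup_adherent a2 hS.
have sS N : s N <= sup S by apply: ub_le_sup; [case: hS|exists N].
pose G : R := \sum_(1 <= p < P.+1 | inclass p) ln p%:R / p%:R.
have G0 : 0 <= G by apply: sumr_ge0 => p _; rewrite divr_ge0 ?ln_nat_ge0.
have HG N : (P < N)%N -> \sum_(1 <= p < N.+1 | inclass p) ln p%:R / p%:R <= G + ln N%:R *
    (a / 2).
  move=> PN; rewrite (@big_cat_nat _ _ _ P.+1) //=; last exact: ltnW.
  rewrite lerD2l; apply: le_trans (_ : ln N%:R * (s N - s P) <= _).
    have -> : s N - s P = \sum_(P.+1 <= p < N.+1 | inclass p) p%:R^-1.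
      by rewrite /s (@big_cat_nat _ _ _ P.+1 1 N.+1) //=; [ring|exact: ltnW].
    rewrite mulr_sumr big_nat_cond [leRHS]big_nat_cond;
        apply: ler_sum => p /andP[/andP[Pp pN] _].
    apply: ler_wpM2r; first by rewrite invr_ge0.
    by apply: ler_ln_nat => //; apply: leq_trans Pp.
  by apply: ler_wpM2l; [exact: ln_nat_ge0|have := sS N; lra].
have [N N0 HN] := ln_nat_unbounded R (`|(G + B') / (a / 2)| + ln P.+1%:R).
have lP : 0 <= ln P.+1%:R :> R by apply: ln_nat_ge0.
have X0 := normr_ge0 ((G + B') / (a / 2)); have X1 := ler_norm ((G + B') / (a / 2)).
have PN : (P < N)%N.
  rewrite ltnNge; apply/negP => NP.
  have : ln N%:R <= ln P.+1%:R :> R by apply: ler_ln_nat => //; apply: leqW.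
  lra.
have := le_trans (H N N0) (HG N PN).
have : (G + B') / (a / 2) < ln N%:R by lra.
rewrite ltr_pdivrMr //; lra.
Qed.

Lemma sum_inv_class_beyond (Q : nat) (B : R) :
  exists N, B < \sum_(Q.+1 <= p < N.+1 | inclass p) p%:R^-1.
Proof.
have B0 : 0 <= \sum_(1 <= p < Q.+1 | inclass p) p%:R^-1 :> R.
  by apply: sumr_ge0 => p _; rewrite invr_ge0.
have [N HN] := sum_inv_class_unbounded
  (`|B| + \sum_(1 <= p < Q.+1 | inclass p) p%:R^-1).
have B1 := ler_norm B; have B2 := normr_ge0 B.
have [QN|NQ] := ltnP Q N; last first.
  have : \sum_(1 <= p < N.+1 | inclass p) p%:R^-1 <= \sum_(1 <= p < Q.+1 | inclass p)
      p%:R^-1 :> R.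
    by rewrite [leRHS](@big_cat_nat _ _ _ N.+1) //= lerDl sumr_ge0 // => p _;
        rewrite invr_ge0.
  lra.
exists N; move: HN; rewrite [X in _ < X](@big_cat_nat _ _ _ Q.+1) //=; last exact: ltnW.
lra.
Qed.

Lemma prime_in_class_beyond (Q : nat) : exists q, [/\ prime q, q = h %[mod k] & (Q < q)%N].
Proof.
have [N HN] := sum_inv_class_beyond Q 0.
apply: contrapT => Hno; move: HN;
    rewrite big_nat_cond big1 ?ltxx // => p /andP[/andP[Qp _] /andP[pp /eqP ph]].
by case: Hno; exists p.
Qed.

Lemma prod_class_small (Q : nat) (y : R) : 0 < y ->
  exists X, \prod_(Q.+1 <= p < X.+1 | inclass p) (1 - p%:R^-1) <= y.
Proof.
move=> y0; have [X HX] := sum_inv_class_beyond Q (- ln y); exists X.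
apply: le_trans (_ : expR (- \sum_(Q.+1 <= p < X.+1 | inclass p) p%:R^-1) <= _).
  rewrite -sumrN expR_sum; apply: ler_prod => p /andP[pp _].
  rewrite expR_ge1Dx subr_ge0 andbT invf_le1 ?ltr0n ?ler1n prime_gt0 //.
rewrite -[leRHS]lnK ?posrE // ler_expR; lra.
Qed.

End PrimeReciprocals.

(** * Density of the values of the totient ratio *)

Lemma prod_all_prime_gt0 (s : seq nat) : all prime s -> (0 < \prod_(p <- s) p)%N.
Proof. by move=> sp; rewrite big_seq; apply: prodn_cond_gt0 => p /(allP sp)/prime_gt0. Qed.

Section SquarefreeProducts.
Variable l : seq nat.
Hypotheses (lp : all prime l) (lu : uniq l).
Let m := (\prod_(p <- l) p)%N.

Lemma prod_primes_gt0 : (0 < m)%N.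
Proof.
exact: prod_all_prime_gt0.
Qed.

Lemma prime_dvd_prod p : prime p -> (p %| m)%N = (p \in l).
Proof.
rewrite /m => pp; elim: l lp => [|q s IH] /=;
    first by rewrite big_nil dvdn1 gtn_eqF // prime_gt1.
by move=> /andP[qp sp]; rewrite big_cons Euclid_dvdM // IH // inE dvdn_prime2.
Qed.

Lemma logn_prod_primes p : prime p -> logn p m = (p \in l).
Proof.
rewrite /m => pp; elim: l lp lu => [|q s IH] /=; first by rewrite big_nil logn1.
move=> /andP[qp sp] /andP[qs su];
    rewrite big_cons lognM ?(prime_gt0 qp) ?prod_all_prime_gt0 //.
rewrite logn_prime // IH // inE.
by case: eqP => // ->; rewrite (negPf qs).
Qed.

Lemma squarefree_prod_primes : squarefree m.
Proof.
move=> j jm; have j0 : (0 < j)%N.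
  by case: j jm => //; rewrite dvd0n => /eqP E; have := prod_primes_gt0; rewrite E.
apply/eqP; rewrite eqn_leq j0 andbT leqNgt; apply/negP => j1.
have pp := pdiv_prime j1.
have := dvdn_leq_log (pdiv j) prod_primes_gt0 jm.
rewrite lognX logn_prod_primes // => H.
have : (0 < logn (pdiv j) j)%N by rewrite logn_gt0 mem_primes pp j0 pdiv_dvd.
by move: H; case: (_ \in _); lia.
Qed.

Lemma coprime_prod_primes x : (0 < x)%N -> (forall p, p \in l -> (x < p)%N) -> coprime m x.
Proof.
move=> x0 lx; rewrite coprime_sym /m big_seq; elim/big_ind: _ => [|u v cu cv|p pl].
- exact: coprimen1.
- by rewrite coprimeMr cu.
- by rewrite coprime_sym prime_coprime ?(allP lp p pl) // gtnNdvd // lx.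
Qed.

Lemma totient_prod_primes (R : realType) :
  (totient m)%:R / m%:R = \prod_(p <- l) (1 - p%:R^-1) :> R.
Proof.
rewrite /m; elim: l lp lu => [|q s IH] /=; first by rewrite !big_nil divr1.
move=> /andP[qp sp] /andP[qs su]; rewrite !big_cons -IH //.
have s0 : (0 < \prod_(p <- s) p)%N.
  exact: prod_all_prime_gt0.
rewrite totient_coprime; last first.
  rewrite prime_coprime // big_seq; elim/big_ind: _ => [|u v|p ps].
  - by rewrite dvdn1 gtn_eqF // prime_gt1.
  - by rewrite Euclid_dvdM // => /negPf -> /negPf ->.
  - by rewrite dvdn_prime2 ?(allP sp p ps) //; apply: contra qs => /eqP ->.
have q0 := prime_gt0 qp.
rewrite totient_prime // !natrM -subn1 natrB //.
by field; rewrite !pnatr_eq0 -!lt0n q0 s0.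
Qed.

End SquarefreeProducts.

Section Density.
Variable R : realType.

(** The greedy argument. Take q so large that 1 - 1/q lies above y and 1/q < e. Multiply
    by the factors 1 - 1/p of the primes p = 1 mod a beyond q until the product falls
    to y or below, which happens because the full product is 0. The last factor is at
    least 1 - 1/q, so that the product is then above y - e. *)
Lemma totient_ratio_approx (a a' r T : nat) (y e : R) :
  (0 < a)%N -> (0 < a')%N -> coprime a' r -> 0 < y < 1 -> 0 < e ->
  exists q s, [/\ prime q, q = r %[mod a'] & (T < q)%N] /\
  [/\ uniq (q :: s), all prime s, all (fun p => p == 1 %[mod a])%N s,
      (forall p, p \in s -> (q < p)%N) &
      y - e < \prod_(p <- q :: s) (1 - p%:R^-1) <= y].
Proof.
move=> a0 a'0 a'r /andP[y0 y1] e0.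
pose Q := (T + (Num.bound (1 - y)^-1 + Num.bound e^-1))%N.
have [q [qp qr qQ]] := prime_in_class_beyond R a' r a'0 a'r Q.
have qR : 0 < q%:R :> R by rewrite ltr0n prime_gt0.
have big_bound (x : R) : 0 < x -> (Num.bound x^-1 < q)%N -> q%:R^-1 < x.
  move=> x0 xq; rewrite -[x]invrK ltf_pV2 ?posrE ?invr_gt0 //.
  apply: lt_le_trans (archi_boundP (ltW _)) _; first by rewrite invr_gt0.
  by rewrite ler_nat ltnW.
have qy : q%:R^-1 < 1 - y by apply: big_bound; [lra|rewrite /Q in qQ; lia].
have qe : q%:R^-1 < e by apply: big_bound; [lra|rewrite /Q in qQ; lia].
pose cl p := prime p && (p == 1 %[mod a])%N.
pose P X : R := \prod_(q.+1 <= p < X.+1 | cl p) (1 - p%:R^-1).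
have [X0 HX0] := prod_class_small R a 1 a0 (coprimen1 a) q y y0.
have fac p : prime p -> 0 <= 1 - (p%:R^-1 : R) <= 1.
  move=> pp; have p1 := prime_gt0 pp.
  by rewrite gerBl invr_ge0 ler0n subr_ge0 invf_le1 ?ltr0n // ler1n p1.
have P0 X : 0 <= P X.
  by apply: prodr_ge0 => p /andP[/fac/andP[]].
have exX : exists X, (1 - q%:R^-1) * P X <= y.
  exists X0; apply: le_trans HX0; apply: ler_piMl; first exact: P0.
  by have /andP[] := fac _ qp.
have [X HX minX] := ex_minnP exX.
exists q, [seq p <- index_iota q.+1 X.+1 | cl p]; split.
  by split => //; rewrite /Q in qQ; lia.
have mem p : p \in [seq p <- index_iota q.+1 X.+1 | cl p] -> (q < p)%N /\ cl p.
  by rewrite mem_filter mem_index_iota => /andP[-> /andP[-> _]].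
split.
- rewrite /= filter_uniq ?iota_uniq // andbT; apply/negP => /mem[]; by rewrite ltnn.
- by apply/allP => p /mem[_ /andP[]].
- by apply/allP => p /mem[_ /andP[]].
- by move=> p /mem[].
rewrite big_cons big_filter -/(P X) HX andbT.
have qX : (q < X)%N.
  rewrite ltnNge; apply/negP => Xq; move: HX; rewrite /P big_geq // mulr1; lra.
case: X HX minX mem qX => // X HX minX mem qX.
have PX : y < (1 - q%:R^-1) * P X.
  by rewrite ltNge; apply/negP => /minX; rewrite ltnn.
have step : P X * (1 - q%:R^-1) <= P X.+1.
  rewrite /P big_mkcond [leRHS]big_mkcond [leRHS]big_nat_recr //= -!big_mkcond -/(P X).
  apply: ler_wpM2l; first exact: P0.
  case: ifP => _; last by rewrite gerBl invr_ge0.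
  apply: lerB => //; rewrite lef_pV2 ?posrE ?ltr0n ?(prime_gt0 qp) // ler_nat.
  exact: ltnW.
have /andP[q1 q2] := fac _ qp.
apply: lt_le_trans (ler_wpM2l q1 step).
have : y * (1 - q%:R^-1) < (1 - q%:R^-1) * P X * (1 - q%:R^-1).
  by rewrite ltr_pM2r //; lra.
have : y * q%:R^-1 <= q%:R^-1 by apply: ler_piMl; [rewrite invr_ge0|lra].
lra.
Qed.
End Density.

(** * Values of the totient along an affine sequence *)

Section AffineValues.
Lemma gcd_ab_gt0 a b : (0 < a)%N -> (0 < gcd_ab a b)%N.
Proof. by move=> a0; rewrite gcdn_gt0 a0. Qed.

(** Divide a n + b = g m by g = (a, b): the values are the m congruent to b / g modulo
    a / g, a class prime to the modulus. Large m correspond to positive n. *)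
Lemma lin_represents_residue (a : nat) (b : int) : (0 < a)%N ->
  exists r : nat, coprime (a %/ gcd_ab a b) r /\
  forall m : nat, m = r %[mod a %/ gcd_ab a b] -> (`|b|%N < m)%N ->
  exists2 n, (0 < n)%N & a%:Z * n%:Z + b = (gcd_ab a b * m)%N%:Z.
Proof.
move=> a0; have g0 := gcd_ab_gt0 a b a0; set g := gcd_ab a b in g0 *.
set a' := (a %/ g)%N.
have aE : a = (a' * g)%N by rewrite divnK // dvdn_gcdl.
have a'0 : (0 < a')%N by move: a0; rewrite aE muln_gt0 => /andP[].
pose b' := (b %/ g%:Z)%Z.
have bE : b = b' * g%:Z by rewrite divzK // dvdzE dvdn_gcdr.
have cop : coprime a' `|b'|.
  have : gcdn (a' * g) (`|b'| * g) = g.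
    by rewrite -aE (_ : (`|b'| * g)%N = `|b|%N) // bE abszM.
  rewrite -muln_gcdl => /eqP; rewrite -[X in _ == X]mul1n eqn_pmul2r //.
have am0 : a'%:Z != 0 by rewrite -lt0n in a'0 *; case: (a') a'0.
exists `|(b' %% a'%:Z)%Z|%N; split.
  have : coprimez a' (b' %% a'%:Z)%Z by rewrite /coprimez gcdzC gcdz_modl gcdzC.
  by [].
move=> m mr bm.
have rE : (`|(b' %% a'%:Z)%Z|%N : int) = (b' %% a'%:Z)%Z by rewrite gez0_abs // modz_ge0.
have /dvdzP[z zE] : (a'%:Z %| m%:Z - b')%Z.
  by rewrite -eqz_mod_dvd; apply/eqP; rewrite modz_nat mr -modz_nat rE modz_mod.
have b'b : (`|b'| <= `|b|)%N by rewrite bE abszM leq_pmulr.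
have za : 0 < z * a'%:Z by rewrite -zE subr_gt0; move: b'b bm; lia.
have z0 : 0 < z by rewrite pmulr_lgt0 in za => //; rewrite ltz_nat.
exists `|z|%N; first by rewrite absz_gt0 gt_eqF.
rewrite gez0_abs ?ltW // aE bE !PoszM.
have -> : m%:Z = z * a'%:Z + b' by rewrite -zE subrK.
by rewrite /=; ring.
Qed.

Variables (R : realType) (a : nat) (b : int) (c d : R).
Hypotheses (ha : (0 < a)%N) (hc : 0 < c).
Let g := gcd_ab a b.
Let g0 : (0 < g)%N := gcd_ab_gt0 a b ha.

Lemma M_set_positive n : M_set a b c d n -> (0 < lin a b n)%N /\ 0 < c * n%:R + d.
Proof.
move=> [n0]; rewrite gt_max => /andP[h1 h2] _.
have aR : 0 < a%:R :> R by rewrite ltr0n.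
split.
  rewrite /lin absz_gt0 gt_eqF // -(ltr0z R) rmorphD rmorphM /=.
  rewrite -subr_gt0 opprK -(pmulr_rgt0 _ aR) mulrDr [a%:R * (_ / _)]mulrC divfK ?gt_eqF
      // in h1.
rewrite -subr_gt0 opprK -(pmulr_rgt0 _ hc) mulrDr [c * (_ / _)]mulrC divfK ?gt_eqF // in h2.
Qed.

Lemma ratio_bounds n : M_set a b c d n -> 0 < Defs.ratio a b c d n <= D_bound a b c.
Proof.
move=> Mn; have [l0 c0] := M_set_positive _ Mn; have [_ _ ->] := Mn.
by rewrite andbT divr_gt0 // ltr0n totient_gt0.
Qed.

Lemma D_bound_gt0 : 0 < D_bound a b c.
Proof. by rewrite divr_gt0 ?mulr_gt0 ?ltr0n ?muln_gt0 ?ha ?totient_gt0. Qed.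

(** With W = g m = a n + b, the denominator c n + d is (c / a) (W + e) for a constant e,
    and phi (g m) = phi g phi m, so that the ratio is D (phi m / m) W / (W + e). *)
Lemma ratio_factor n m : a%:Z * n%:Z + b = (g * m)%N%:Z -> (0 < m)%N -> coprime g m ->
  let e := a%:R * d / c - b%:~R in
  c * n%:R + d = c / a%:R * ((g * m)%:R + e) /\
  (0 < (g * m)%:R + e -> Defs.ratio a b c d n * ((g * m)%:R + e) =
    D_bound a b c * ((totient m)%:R / m%:R) * (g * m)%:R).
Proof.
move=> E m0 gm e.
have aR : a%:R != 0 :> R by rewrite pnatr_eq0 -lt0n.
have gR : g%:R != 0 :> R by rewrite pnatr_eq0 -lt0n.
have mR : m%:R != 0 :> R by rewrite pnatr_eq0 -lt0n.
have cR : c != 0 by rewrite gt_eqF.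
have ER : a%:R * n%:R + b%:~R = (g * m)%:R :> R.
  by have := congr1 (fun z : int => z%:~R : R) E; rewrite rmorphD rmorphM /=.
have H : c * n%:R + d = c / a%:R * ((g * m)%:R + e).
  by rewrite -ER /e; field; rewrite aR cR.
split=> //.
rewrite /Defs.ratio H /D_bound -/g /lin E /= totient_coprime //.
move=> We; rewrite -/g !natrM; field.
by rewrite mR gR cR aR -natrM gt_eqF.
Qed.

Lemma prod_eq1_mod (s : seq nat) k : all (fun p => p == 1 %[mod k])%N s ->
  \prod_(p <- s) p = 1 %[mod k].
Proof.
elim: s => [|p s IH] /=; first by rewrite big_nil.
by move=> /andP[/eqP p1 /IH s1]; rewrite big_cons -modnMm p1 s1 modnMm.
Qed.

(** The three conditions are met simultaneously, which gives the density for each of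
    them, and for the unrestricted set, at once. *)
Definition all_conditions t n :=
  [/\ squarefree (lin_red a b n), coprime (lin_red a b n) t
    & almost_all_primes_1mod a (lin_red a b n)].

Lemma leq_addends4 (u v w z : nat) :
  [/\ u <= u + v + w + z, v <= u + v + w + z, w <= u + v + w + z
    & z <= u + v + w + z]%N.
Proof. by split; lia. Qed.

(** By [ratio_factor] the ratio is D rho th, where rho = phi m / m and th tends to 1 as m
    grows. Choosing rho slightly below y = x / D keeps the ratio below D despite
    the factor th, because y < 1; this is why the upper end x = D is excluded here
    and recovered by closure. *)
Lemma approx_all_conditions t (x eps : R) : (0 < t)%N -> 0 < x < D_bound a b c -> 0 < eps ->
  exists n, [/\ M_set a b c d n, all_conditions t n & `|x - Defs.ratio a b c d n| < eps].
Proof.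
move=> t0 /andP[x0 xD] e0; set D := D_bound a b c in xD *.
have D0 : 0 < D by apply: D_bound_gt0.
have [r [a'r Hlin]] := lin_represents_residue a b ha; rewrite -/g in a'r Hlin.
set a' := (a %/ g)%N in a'r Hlin.
have a'a : (a' %| a)%N by rewrite dvdn_div // dvdn_gcdl.
have a'0 : (0 < a')%N by rewrite (dvdn_gt0 ha a'a).
pose y := x / D.
have yD : x = D * y by rewrite /y mulrC divfK ?gt_eqF.
have y01 : 0 < y < 1 by rewrite divr_gt0 //= ltr_pdivrMr // mul1r.
have [y0 y1] := andP y01.
(* Both rho and th are approximated within del: the first bound makes rho th at most 1,
   the second one makes the error, at most 2 D del, smaller than eps. *)
pose del := Num.min (1 - y) (eps / (4 * D)).
have del0 : 0 < del by rewrite lt_min subr_gt0 y1 divr_gt0 // mulr_gt0.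
have del1 : del <= 1 - y by rewrite ge_min lexx.
have del2 : del <= eps / (4 * D) by rewrite ge_min lexx orbT.
pose e := a%:R * d / c - b%:~R.
(* W > Wmin makes W + e positive and |e| / (W + e) < del. *)
pose Wmin := `|e| + `|e| / del + 1.
have Wmin0 : 0 <= Wmin by rewrite !addr_ge0 // divr_ge0 // ltW.
(* All prime factors of m exceed T, hence are prime to g and t; moreover
   m > |b| and g m > Wmin. *)
pose T := (g + t + `|b|%N + Num.bound Wmin)%N.
have [Tg Tt Tb TW] := leq_addends4 g t `|b|%N (Num.bound Wmin); rewrite -/T in Tg Tt Tb TW.
have [q [s [[qp qr Tq] [su sp s1 sq /andP[rho1 rho2]]]]] :=
  totient_ratio_approx R a a' r T y del ha a'0 a'r y01 del0.
pose l := q :: s; have lp : all prime l by rewrite /= qp.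
pose m := (\prod_(p <- l) p)%N.
have m0 : (0 < m)%N := prod_primes_gt0 l lp.
have lT p : p \in l -> (T < p)%N.
  by rewrite inE => /predU1P[->//|/sq]; apply: ltn_trans.
have mT : (T < m)%N.
  apply: leq_trans Tq _; rewrite dvdn_leq //.
  by rewrite (prime_dvd_prod l lp) // inE eqxx.
have mr : m = r %[mod a'].
  rewrite /m /l big_cons -modnMm qr.
  have -> : \prod_(p <- s) p = 1 %[mod a'].
    by rewrite -(modn_dvdm (\prod_(p <- s) p) a'a) (prod_eq1_mod _ _ s1) modn_dvdm.
  by rewrite modnMm muln1.
have bm : (`|b|%N < m)%N by exact: leq_ltn_trans Tb mT.
have [n n0 nE] := Hlin m mr bm.
have red : lin_red a b n = m by rewrite /lin_red /lin nE mulKn.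
exists n.
have gm : coprime g m.
  rewrite coprime_sym; apply: (coprime_prod_primes l lp) => // p /lT; exact: leq_ltn_trans.
have [cE rE] := ratio_factor n m nE m0 gm; rewrite -/e in cE rE.
have WT : Wmin < (g * m)%:R.
  apply: lt_trans (archi_boundP Wmin0) _; rewrite ltr_nat.
  exact: leq_trans (leq_ltn_trans TW mT) (leq_pmull m g0).
set W : R := (g * m)%:R in WT cE rE.
have en := ler_norm (- e); rewrite normrN in en.
have ed0 : 0 <= `|e| / del by rewrite divr_ge0 // ltW.
have We1 : `|e| / del < W + e by rewrite /Wmin in WT; lra.
have We0 : 0 < W + e by lra.
have {}rE := rE We0.
set rho : R := (totient m)%:R / m%:R in rE; rewrite -/D in rE.
have rhoE : rho = \prod_(p <- l) (1 - p%:R^-1) := totient_prod_primes l lp su R.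
pose th := W / (W + e).
have th1 : `|th - 1| <= del.
  have -> : th - 1 = - e / (W + e).
    by rewrite /th -[X in _ - X](divff (lt0r_neq0 We0)) -mulrBl opprD addNKr.
  rewrite normrM normrN normfV (gtr0_norm We0) ler_pdivrMr //.
  by rewrite -ler_pdivrMl // mulrC ltW.
have ratE : Defs.ratio a b c d n = D * (rho * th).
  apply: (mulIf (lt0r_neq0 We0)); rewrite rE.
  by rewrite -[RHS]mulrA -[X in _ = _ * X]mulrA divfK ?lt0r_neq0 // mulrA.
have rho0 : 0 <= rho by rewrite divr_ge0.
rewrite -rhoE in rho1 rho2.
have [th2 th3] : 1 - del <= th /\ th <= 1 + del.
  by move: th1; rewrite ler_norml => /andP[? ?]; split; lra.
have th0 : 0 <= th by rewrite divr_ge0 // ltW.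
have up : rho * th <= y + del.
  have h1 := ler_wpM2r th0 rho2.
  have h2 := ler_wpM2l (ltW y0) th3.
  have h3 : y * del <= del by apply: ler_piMl; lra.
  lra.
have dn : y - 2 * del < rho * th.
  have [yd|yd] := leP y del.
    have := mulr_ge0 rho0 th0; lra.
  have h1 := ler_wpM2l rho0 th2.
  have h2 : rho * del <= del by apply: ler_piMl; lra.
  lra.
split.
- split => //.
    rewrite gt_max; apply/andP; split.
      rewrite -subr_gt0 opprK.
      have -> : n%:R + b%:~R / a%:R = W / a%:R.
        have := congr1 (fun z : int => z%:~R : R) nE; rewrite rmorphD rmorphM /= => h.
        by rewrite /W -[(g * m)%:R]h; field; rewrite pnatr_eq0 -lt0n.
      by rewrite divr_gt0 ?ltr0n // ?muln_gt0 ?g0.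
    rewrite -subr_gt0 opprK.
    have -> : n%:R + d / c = (c * n%:R + d) / c by field; rewrite gt_eqF.
    by rewrite divr_gt0 // cE mulr_gt0 // divr_gt0 // ltr0n.
  rewrite -/D ratE -[leRHS]mulr1; apply: ler_wpM2l; first exact: ltW.
  lra.
- rewrite /all_conditions red; split.
  + exact: squarefree_prod_primes.
  + apply: (coprime_prod_primes l lp) => // p /lT; exact: leq_ltn_trans.
    (* Among the prime factors of m only q may fail to be 1 modulo a. *)
have exq p : exceptional_prime a m p -> p = q.
    move=> [pp]; rewrite (prime_dvd_prod l lp) // inE => /predU1P[//|ps].
    by have /eqP := allP s1 p ps.
  split=> [p p' /exq-> /exq->//|p pe].
  split.
    by have [pp pm _] := pe; rewrite (logn_prod_primes l lp su) // -(prime_dvd_prod l lp)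
        // pm.
  by have [_ _] := pe; case: (a) ha => [|[|]] // _; rewrite !modn1.
rewrite ratE yD -mulrBr normrM (gtr0_norm D0).
apply: le_lt_trans (_ : _ <= D * (2 * del)) _.
  by apply: ler_wpM2l; [exact: ltW|rewrite ler_norml; apply/andP; split; lra].
have D4 : 0 < 4 * D by rewrite pmulr_rgt0.
by move: del2; rewrite (ler_pdivlMr _ _ D4); lra.
Qed.

Lemma dense_of_all_conditions t (P : nat -> Prop) : (0 < t)%N -> (forall n,
    all_conditions t n -> P n) ->
  dense_in [set x | 0 < x <= D_bound a b c] (L_restr a b c d P).
Proof.
move=> t0 gP; split.
  by move=> _ [n [Mn _] <-]; apply: ratio_bounds.
move=> x /= /andP[x0 xD] B /nbhs_ballP[eps /= e0 xB].
(* The target x - eta lies strictly inside the interval, even for x = D. *)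
pose eta := Num.min eps x / 2.
have eta0 : 0 < eta by rewrite divr_gt0 // lt_min e0.
have eta1 : eta <= eps / 2 by rewrite ler_pM2r ?invr_gt0 // ge_min lexx.
have eta2 : eta <= x / 2 by rewrite ler_pM2r ?invr_gt0 // ge_min lexx orbT.
have e2 : 0 < eps / 2 by rewrite divr_gt0.
have x' : 0 < x - eta < D_bound a b c by apply/andP; split; lra.
have [n [Mn Gn Hn]] := approx_all_conditions t (x - eta) (eps / 2) t0 x' e2.
exists (Defs.ratio a b c d n); split; first by exists n => //; split => //; apply: gP.
apply: xB; rewrite /ball /=.
have -> : x - Defs.ratio a b c d n = eta + (x - eta - Defs.ratio a b c d n) by ring.
by apply: le_lt_trans (ler_normD _ _) _; rewrite (gtr0_norm eta0); lra.
Qed.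

End AffineValues.

Theorem theorem1 (R : realType) (a : nat) (b : int) (c d : R)
    (ha : (0 < a)%N) (hc : 0 < c) :
  let I : set R := [set x | 0 < x <= D_bound a b c] in
  dense_in I (L_set a b c d) /\
  forall t : nat, (0 < t)%N ->
    [/\ dense_in I (L_restr a b c d (fun n => squarefree (lin_red a b n))),
        dense_in I (L_restr a b c d (fun n => coprime (lin_red a b n) t))
      & dense_in I (L_restr a b c d
                      (fun n => almost_all_primes_1mod a (lin_red a b n)))].
Proof.
split.
  have -> : L_set a b c d = L_restr a b c d (fun=> True).
    by rewrite /L_set /L_restr; congr image; apply/seteqP; split=> n /= => [|[]].
  exact: (dense_of_all_conditions R a b c d ha hc 1%N).
move=> t t0.
by split; apply: (dense_of_all_conditions R a b c d ha hc t) => // n [].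
Qed.
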